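(* Let $L>0$, let $\mathbf k\in (L^{-1}\mathbb Z)^2\setminus\{0\}$ be fixed, put $k=|\mathbf k|$, and let $\rho_0$ satisfy the density assumption of the context. Then there exists an infinite sequence of characteristic values $\{\lambda_n(\mathbf k)\}_{n\ge 1}$, decreasing towards $0$ as $n\to\infty$, such that for $\lambda=\lambda_n(\mathbf k)$ the boundary value problem $$\lambda^2\big(k^2\rho_0\phi-(\rho_0\phi')'\big)+\lambda\mu\big(\phi^{(4)}-2k^2\phi''+k^4\phi\big)=gk^2\rho_0'\phi\quad\text{on }(-\infty,0),$$ $$\mu\big(k^2\phi(0)+\phi''(0)\big)=0,\qquad -\lambda\mu\phi'''(0)+(3\lambda\mu k^2+\lambda^2\rho_+)\phi'(0)+gk^2\rho_+\phi(0)=0,$$ $$\lim_{x_3\to-\infty}\phi(x_3)=0$$ has a (nontrivial) solution $\phi_n\in H^\infty((-\infty,0))$.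
   Context: Constants $g>0$ (gravity), $\mu>0$ (viscosity), $a>0$ are fixed. Density assumption: $\rho_0:(-\infty,0]\to\mathbb R$ is smooth (up to the boundary), $\rho_0'\ge 0$, $\operatorname{supp}\rho_0'=[-a,0]$, $\rho_0(x_3)=\rho_->0$ for all $x_3\le -a$, and $\rho_0(0)=\rho_+$. A characteristic value (for $\mathbf k$) is a number $\lambda\in\mathbb C$ with $\operatorname{Re}\lambda>0$ for which the boundary value problem in the claim has a nontrivial solution $\phi\in H^4((-\infty,0))$. $H^\infty=\bigcap_{s\ge0}H^s$. *)

(* Defs.v *)
From mathcomp Require Import all_boot all_order all_algebra.
From mathcomp Require Import all_classical all_reals all_analysis.
From mathcomp Require Import complex.

Set Implicit Arguments.
Unset Strict Implicit.
Unset Printing Implicit Defensive.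

Import Order.TTheory GRing.Theory Num.Theory.
Import numFieldNormedType.Exports.

Local Open Scope ring_scope.
Local Open Scope complex_scope.
Local Open Scope classical_set_scope.

Definition half_line (R : realType) : set R := [set x | x < 0].
Arguments half_line : clear implicits.

(** ** Sobolev spaces on the half-line

    A function on (-oo, 0) is represented by a total function whose values
    outside (-oo, 0) are irrelevant.  Complex-valued functions are integrated
    componentwise. *)

(* C^oo functions whose support is a compact subset of (-oo, 0) *)
Definition test_function (R : realType) (psi : R -> R) : Prop :=
  (forall (n : nat) (x : R), derivable (psi^`(n)) x 1) /\
  (exists b c : R, c < 0 /\ forall x : R, psi x != 0 -> b <= x <= c).

Definition cvalued (R : realType) (P : (R -> R) -> Prop) (u : R -> R[i]) :
    Prop :=
  P (fun x => complex.Re (u x)) /\ P (fun x => complex.Im (u x)).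

Definition cintegral (R : realType) (u : R -> R[i]) : R[i] :=
  Complex (\int[lebesgue_measure]_(x in half_line R) complex.Re (u x))
          (\int[lebesgue_measure]_(x in half_line R) complex.Im (u x)).

Definition square_integrable (R : realType) : (R -> R[i]) -> Prop :=
  cvalued (fun f => f \_ (half_line R) \in Lfun lebesgue_measure 2%:E).

Definition L1loc (R : realType) : (R -> R[i]) -> Prop :=
  cvalued (locally_integrable (half_line R)).

Definition weak_derivative (R : realType) (u v : R -> R[i]) : Prop :=
  [/\ L1loc u, L1loc v &
      forall psi : R -> R, test_function psi ->
        cintegral (fun x => u x * (psi^`()%classic x)%:C) =
        - cintegral (fun x => v x * (psi x)%:C)].

(* d 0, ..., d m represent u, u', ..., u^(m), all of them in L^2(-oo, 0) *)
Definition sobolev_jet (R : realType) (m : nat) (u : R -> R[i])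
    (d : nat -> R -> R[i]) : Prop :=
  [/\ ae_eq lebesgue_measure (half_line R) u (d 0%N),
      forall j : nat, (j <= m)%N -> square_integrable (d j) &
      forall j : nat, (j < m)%N -> weak_derivative (d j) (d j.+1)].

Definition in_H (R : realType) (m : nat) (u : R -> R[i]) : Prop :=
  exists d : nat -> R -> R[i], sobolev_jet m u d.

Definition in_Hinfty (R : realType) (u : R -> R[i]) : Prop :=
  forall m : nat, in_H m u.

(* The same jet with the derivatives of order < m taken in their continuous
   representatives on (-oo, 0], so that d j 0 (j < m) is the boundary value
   (trace) of u^(j) at 0. *)
Definition continuous_jet (R : realType) (m : nat) (u : R -> R[i])
    (d : nat -> R -> R[i]) : Prop :=
  sobolev_jet m u d /\
  (forall j : nat, (j < m)%N ->
     cvalued (fun f : R -> R => {within [set x : R | x <= 0], continuous f})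
             (d j)).

Definition nontrivial (R : realType) (u : R -> R[i]) : Prop :=
  ~ ae_eq lebesgue_measure (half_line R) u (fun=> 0).

(** ** Density profile *)

(* f and all its derivatives on (-oo, 0) extend continuously to (-oo, 0] *)
Definition smooth_upto_boundary (R : realType) (f : R -> R) : Prop :=
  [/\ forall (n : nat) (x : R), x < 0 -> derivable (f^`(n)) x 1,
      forall n : nat, cvg (f^`(n) x @[x --> (0 : R)^'-]) &
      f x @[x --> (0 : R)^'-] --> f 0].

(* The closure of {x < 0 | rho0' x <> 0} is supp rho0': by continuity the
   (one-sided) derivative at the endpoint 0 does not affect the closure. *)
Definition density_assumption (R : realType) (a rhom rhop : R)
    (rho0 : R -> R) : Prop :=
  [/\ smooth_upto_boundary rho0,
      forall x : R, x < 0 -> 0 <= rho0^`() x,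
      closure [set x : R | x < 0 /\ rho0^`() x != 0] =
        [set x : R | - a <= x <= 0],
      0 < rhom /\ (forall x : R, x <= - a -> rho0 x = rhom) &
      rho0 0 = rhop].

(** ** Boundary value problem *)

(* d 0, ..., d 4 are phi, ..., phi^(4), and w is (rho0 phi')'. *)
Definition bvp_solution (R : realType) (g mu k rhop : R) (rho0 : R -> R)
    (lam : R[i]) (phi : R -> R[i]) : Prop :=
  exists (d : nat -> R -> R[i]) (w : R -> R[i]),
    [/\ continuous_jet 4 phi d,
        weak_derivative (fun x => (rho0 x)%:C * d 1%N x) w,
        {ae lebesgue_measure, forall x : R, x < 0 ->
          lam ^+ 2 * ((k ^+ 2 * rho0 x)%:C * d 0%N x - w x)
          + lam * mu%:C *
            (d 4%N x - (2 * k ^+ 2)%:C * d 2%N x + (k ^+ 4)%:C * d 0%N x)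
          = (g * k ^+ 2 * rho0^`()%classic x)%:C * d 0%N x},
        mu%:C * ((k ^+ 2)%:C * d 0%N 0 + d 2%N 0) = 0 /\
        - (lam * mu%:C * d 3%N 0)
          + (3 * lam * (mu * k ^+ 2)%:C + lam ^+ 2 * rhop%:C) * d 1%N 0
          + (g * k ^+ 2 * rhop)%:C * d 0%N 0 = 0 &
        cvalued (fun f : R -> R => f x @[x --> -oo%R] --> (0 : R)) (d 0%N)].

Definition characteristic_value (R : realType) (g mu k rhop : R)
    (rho0 : R -> R) (lam : R[i]) : Prop :=
  0 < complex.Re lam /\
  exists phi : R -> R[i],
    [/\ in_H 4 phi, nontrivial phi & bvp_solution g mu k rhop rho0 lam phi].

(** ** Wave vectors *)

(* (L^-1 Z)^2 *)
Definition frequency_lattice (R : realType) (L : R) (kv : 'rV[R]_2) : Prop :=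
  forall i : 'I_2, exists z : int, kv 0 i = L^-1 * z%:~R.

(* The library norm on 'rV_2 is the sup norm. *)
Definition euclidean_norm (R : realType) (kv : 'rV[R]_2) : R :=
  Num.sqrt (\sum_(i < 2) kv 0 i ^+ 2).

(* Main.v *)
(* It suffices to find a characteristic value in (0, e) for each
   e > 0.  Write lambda = mu (tau^2 - k^2) / rho_-; on (-oo, -a] the decaying
   solutions are spanned by e^(k x) and e^(tau x), so the problem reduces to a
   boundary value problem on [-a, 0] which is symmetric, with a quadratic form
   Q_tau that increases with tau.  If no value tau in (k, T) were
   characteristic, the problem with source f would have a solution
   phi_tau = S_tau f for each tau in (k, T), depending continuously on tau, and
   Green's identity shows that <f, S_tau f> is nonincreasing in tau.  Apply
   this to f = L_tau psi for a bump psi of width delta around a point where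
   rho_0' > 0: as tau -> k, <f, S_tau f> = Q_tau(psi) tends to
   - g k^2 \int rho_0' psi^2 <= - c delta, whereas at a fixed tau' in (k, T)
   |<f, S_tau' f>| <= C ||f||_{L^2} ||f||_{L^1} = O(delta^(3/2)), which is
   impossible for small delta. *)

Require Import Defs.
From mathcomp Require Import all_boot all_order all_algebra.
From mathcomp Require Import all_classical all_reals all_analysis.
From mathcomp Require Import complex.
From mathcomp Require Import ring lra measurable_realfun.

Set Implicit Arguments.
Unset Strict Implicit.
Unset Printing Implicit Defensive.

Import Order.TTheory GRing.Theory Num.Theory.
Import numFieldNormedType.Exports.

Local Open Scope classical_set_scope.
Local Open Scope ring_scope.
Local Open Scope complex_scope.

(** On [e^(theta x)] the exterior equation with density [rho_-] acts as multiplication by lambda mu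
    (theta^2 - k^2)(theta^2 - tau^2); this is the origin of tau, and it makes every tau-dependence
    polynomial.

    No derivative of phi_tau in tau is needed. Green's identity for phi_s and phi_t with the same
    source gives <f, phi_s> - <f, phi_t> = - (Q_s - Q_t)(phi_s, phi_t). The gravity term, the only
    indefinite one, does not depend on tau and cancels; the rest carries a factor s - t, and its
    divided difference tends to a nonnegative form in phi_t by mere continuity.

    No compactness or spectral theory enters: S_tau comes from a 2 by 2 linear system, whose
    determinant can vanish only at a characteristic value.

    The order of choices matters: tau' comes first, so that C is independent of f; then delta; and
    only then tau near k, because the derivatives of psi blow up as delta shrinks. With tau so close
    to k, f is bounded uniformly in delta, which is why its L^2 norm is O(delta^(1/2)) and its L^1
    norm O(delta). *)

(* Pointwise forms of the derivation rules: they elaborate without the type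
   class search of the library instances, which diverges on long products. *)
Section pointwise_derivation.
Variables (R : realType) (x : R).
Implicit Types f h : R -> R.

Lemma pderD f h a b : is_derive x 1 f a -> is_derive x 1 h b ->
  is_derive x 1 (fun t => f t + h t) (a + b).
Proof. exact: is_deriveD. Qed.

Lemma pderB f h a b : is_derive x 1 f a -> is_derive x 1 h b ->
  is_derive x 1 (fun t => f t - h t) (a - b).
Proof. exact: is_deriveB. Qed.

Lemma pderN f a : is_derive x 1 f a -> is_derive x 1 (fun t => - f t) (- a).
Proof. exact: is_deriveN. Qed.

Lemma pderZ f c a : is_derive x 1 f a ->
  is_derive x 1 (fun t => c * f t) (c * a).
Proof. exact: is_deriveZ. Qed.

Lemma pderM f h a b : is_derive x 1 f a -> is_derive x 1 h b ->
  is_derive x 1 (fun t => f t * h t) (a * h x + f x * b).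
Proof.
move=> df dh; have := is_deriveM df dh.
by rewrite /GRing.scale/= addrC (mulrC (h x)).
Qed.

Lemma pderX f n a : is_derive x 1 f a ->
  is_derive x 1 (fun t => f t ^+ n) (n%:R * f x ^+ n.-1 * a).
Proof.
move=> df; have := is_deriveX n df; rewrite /GRing.scale/=.
by congr is_derive; apply/funext => t; elim: n => // n ih; rewrite !exprS -ih.
Qed.

Lemma pder_expR f a : is_derive x 1 f a ->
  is_derive x 1 (fun t => expR (f t)) (expR (f x) * a).
Proof. by move=> df; exact: (is_derive1_comp (is_derive_expR _) df). Qed.

Lemma pder_cst (c : R) : is_derive x 1 (fun=> c) 0.
Proof. exact: is_derive_cst. Qed.

Lemma pder_id : is_derive x 1 (fun t : R => t) 1.
Proof. exact: is_derive_id. Qed.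

Lemma pder_eq f a b : is_derive x 1 f a -> a = b -> is_derive x 1 f b.
Proof. by move=> ? <-. Qed.

End pointwise_derivation.

(** * Mean value estimates *)

Lemma is_derive_continuous (R : realType) (f : R -> R) (x d : R) :
  is_derive x 1 f d -> {for x, continuous f}.
Proof.
by move=> [df _]; apply: differentiable_continuous; apply/derivable1_diffP.
Qed.

Lemma derive_continuous (R : realType) (f df : R -> R) :
  (forall x : R, is_derive x 1 f (df x)) -> continuous f.
Proof. by move=> h x; exact: is_derive_continuous (h x). Qed.

(** Together with [derive_ge] this replaces integral inequalities: applied to a primitive [H] of
    [h], a pointwise bound on [h] bounds the integral. *)
Lemma derive_le (R : realType) (H h : R -> R) (s t m : R) : s <= t ->
  (forall x, s <= x <= t -> is_derive x 1 H (h x)) ->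
  (forall x, s <= x <= t -> h x <= m) -> H t - H s <= m * (t - s).
Proof.
move=> st dH hm.
have [| |c cst ->] := @MVT_segment R H h s t st.
- by move=> x; rewrite in_itv/= => /andP[sx xt]; apply: dH; rewrite !ltW.
- apply: continuous_in_subspaceT => x /set_mem/=; rewrite in_itv/= => xst.
  exact: is_derive_continuous (dH _ xst).
- by rewrite ler_wpM2r ?subr_ge0// hm// -(in_itv true s t).
Qed.

Lemma derive_ge (R : realType) (H h : R -> R) (s t m : R) : s <= t ->
  (forall x, s <= x <= t -> is_derive x 1 H (h x)) ->
  (forall x, s <= x <= t -> m <= h x) -> m * (t - s) <= H t - H s.
Proof.
move=> st dH hm.
have := @derive_le R (fun x => - H x) (fun x => - h x) s t (- m) st.
have Hh x : s <= x <= t -> is_derive x 1 (fun x => - H x) (- h x).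
  by move=> /dH ?; exact: is_deriveN.
have Hm x : s <= x <= t -> - h x <= - m by move=> /hm; rewrite lerN2.
by move=> /(_ Hh Hm); lra.
Qed.

Lemma le_of_dvd2 (R : realType) (x C : R) :
  (forall n, x <= C * 2^-1 ^+ n) -> x <= 0.
Proof.
move=> h.
have hC : 0 < `|C| + 1 by rewrite ltr_wpDl.
rewrite leNgt; apply/negP => x0.
have := @cvg_geometric R (`|C| + 1) 2^-1.
rewrite ger0_norm ?invr_ge0// invf_lt1 ?ltr1n// => /(_ isT).
move=> /cvgrPdist_lt/(_ _ x0)[N _ /(_ N (leqnn N))] /=.
rewrite sub0r normrN ger0_norm; last first.
  by rewrite mulr_ge0 ?exprn_ge0 ?invr_ge0// ltW.
rewrite ltNge => /negP; apply; apply: (le_trans (h N)).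
rewrite ler_wpM2r ?exprn_ge0 ?invr_ge0//.
by rewrite (le_trans (ler_norm _))// lerDl.
Qed.

(** * Primitives of functions vanishing on a left half-line *)

Definition prim (R : realType) (h : R -> R) (x : R) : R :=
  \int[lebesgue_measure]_(t in `]-oo, x]) h t.

(** For such functions the primitive from -oo is total and again of this kind, so [prim] can be
    iterated four times with no base point to carry along. *)
Definition left0 (R : realType) (a : R) (h : R -> R) : Prop :=
  continuous h /\ forall x, x <= a -> h x = 0.

Section prim.
Variables (R : realType) (a : R).
Implicit Types h : R -> R.

Lemma left0_integrable h u : left0 a h ->
  (@lebesgue_measure R).-integrable `]-oo, u] (EFin \o h).
Proof.
move=> [hc h0].
have i1 : (@lebesgue_measure R).-integrable `[a, u] (EFin \o h).
  apply: continuous_compact_integrable; first exact: segment_compact.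
  exact: continuous_subspaceT.
rewrite integrable_mkcond//= in i1 *.
rewrite integrable_mkcond//=.
apply: eq_integrable i1 => // x _.
rewrite /patch/=; case: ifPn => xa; case: ifPn => xu //.
- move: xa xu; rewrite !inE notin_setE/= !in_itv/= => /andP[_ xu]; by rewrite xu.
- move: xa xu; rewrite notin_setE inE/= !in_itv/= => xa xu.
  rewrite h0//; move: xa; rewrite xu andbT => /negP; rewrite -ltNge.
  exact: ltW.
Qed.

Lemma prim_is_derive h (x : R) : left0 a h -> is_derive x 1 (prim h) (h x).
Proof.
move=> h0.
have [] := @continuous_FTC1 R h -oo%O x (x + 1) _ (left0_integrable _ h0) _ _.
- by rewrite ltrDl.
- by rewrite ltNyr.
- exact: h0.1.
move=> d1 d2; apply: DeriveDef => //.
by rewrite -derive1E.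
Qed.

Lemma prim_left0 h : left0 a h -> left0 a (prim h).
Proof.
move=> h0; split.
  by apply: derive_continuous => x; exact: prim_is_derive.
move=> x xa; rewrite /prim /Rintegral integral0_eq// => y/=.
by rewrite in_itv/= => yx; rewrite h0.2// (le_trans yx).
Qed.

(** In the norm weighted by [expR (- c * x)] one integration gains a factor [1 / c]; a large [c]
    thus makes a Volterra operator a contraction on the whole line at once. *)
Lemma prim_dist (h1 h2 : R -> R) (C c : R) : 0 < c -> 0 <= C ->
  left0 a h1 -> left0 a h2 ->
  (forall x, `|h1 x - h2 x| <= C * expR (c * x)) ->
  forall x, `|prim h1 x - prim h2 x| <= C / c * expR (c * x).
Proof.
move=> c0 C0 h10 h20 h12 x.
have E0 y : 0 <= C / c * expR (c * y).
  by rewrite mulr_ge0 ?expR_ge0// divr_ge0// ltW.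
have [xa|ax] := leP x a.
  by rewrite (prim_left0 h10).2// (prim_left0 h20).2// subrr normr0.
have dE (y : R) : is_derive y 1 (fun y => C / c * expR (c * y)) (C * expR (c * y)).
  have -> : (fun y => C / c * expR (c * y)) = (C / c) *: (expR \o ( *%R c)).
    by apply/funext.
  apply: is_derive_eq; rewrite /GRing.scale/=.
  by field; rewrite gt_eqF.
have d1 (y : R) : is_derive y 1 (prim h1) (h1 y) by exact: prim_is_derive.
have d2 (y : R) : is_derive y 1 (prim h2) (h2 y) by exact: prim_is_derive.
have p1 := (prim_left0 h10).2 a (lexx _).
have p2 := (prim_left0 h20).2 a (lexx _).
rewrite ler_norml; apply/andP; split.
- have := @derive_ge R (fun y => prim h1 y - prim h2 y + C / c * expR (c * y))
    (fun y => h1 y - h2 y + C * expR (c * y)) a x 0 (ltW ax).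
  rewrite mul0r p1 p2 subr0 add0r lerBrDr add0r => H.
  rewrite lerNl -subr_ge0 opprK addrC.
  apply: le_trans (E0 a) _; apply: H.
  by move=> y _; have := h12 y; rewrite ler_norml => /andP[]; lra.
- have := @derive_ge R (fun y => C / c * expR (c * y) - (prim h1 y - prim h2 y))
    (fun y => C * expR (c * y) - (h1 y - h2 y)) a x 0 (ltW ax).
  rewrite mul0r p1 p2 !subr0 lerBrDr add0r => H.
  rewrite -subr_ge0.
  apply: le_trans (E0 a) _; apply: H.
  by move=> y _; have := h12 y; rewrite ler_norml => /andP[]; lra.
Qed.

Lemma left0D h1 h2 : left0 a h1 -> left0 a h2 ->
  left0 a (fun x => h1 x + h2 x).
Proof.
move=> [c1 z1] [c2 z2]; split=> [x|x xa]; last by rewrite z1// z2// addr0.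
by apply: cvgD; [exact: c1|exact: c2].
Qed.

Lemma left0Ml h1 h2 : continuous h1 -> left0 a h2 ->
  left0 a (fun x => h1 x * h2 x).
Proof.
move=> c1 [c2 z2]; split=> [x|x xa]; last by rewrite z2// mulr0.
by apply: cvgM; [exact: c1|exact: c2].
Qed.

Lemma left00 : left0 a (fun=> 0).
Proof. by split=> // x; exact: cvg_cst. Qed.

End prim.

(** * Linear equations of order four *)

Section picard.
Variables (R : realType) (a M : R) (c0 c1 c2 b : R -> R).
Hypotheses (c0c : continuous c0) (c1c : continuous c1) (c2c : continuous c2).
Hypotheses (c0M : forall x, `|c0 x| <= M) (c1M : forall x, `|c1 x| <= M)
  (c2M : forall x, `|c2 x| <= M).
Hypotheses (b0 : left0 a b) (bM : forall x, `|b x| <= M).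

(** The Picard unknown is the fourth derivative: the lower derivatives are its iterated primitives,
    so the equation becomes a Volterra fixed point [u = b + K u]. *)
Let K (u : R -> R) (x : R) : R :=
  c0 x * prim (prim (prim (prim u))) x +
  (c1 x * prim (prim (prim u)) x + c2 x * prim (prim u) x).

Let K0 u : left0 a u -> left0 a (K u).
Proof.
move=> u0; apply: left0D; last apply: left0D; apply: left0Ml => //;
  by repeat apply: prim_left0.
Qed.

(** Each of the three terms of [K] contributes at most [M / c] since [1 <= c]; this value gives
    [3 * M / c <= 1 / 2]. *)
Let c := 6 * M + 1.

Let M0 : 0 <= M. Proof. exact: le_trans (normr_ge0 _) (bM 0). Qed.

Let cge1 : 1 <= c. Proof. by rewrite lerDr mulr_ge0. Qed.
Let cgt0 : 0 < c. Proof. exact: lt_le_trans cge1. Qed.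

Let K_dist (u v : R -> R) (C : R) : 0 <= C -> left0 a u -> left0 a v ->
  (forall x, `|u x - v x| <= C * expR (c * x)) ->
  forall x, `|K u x - K v x| <= C * 2^-1 * expR (c * x).
Proof.
move=> C0 u0 v0 uv x.
have ci : 0 <= c^-1 <= 1.
  by rewrite invr_ge0 ltW//= invf_le1.
have cM : M * 3 * c^-1 <= 2^-1.
  by rewrite ler_pdivrMr// /c; have := M0; lra.
have p1 := prim_dist cgt0 C0 u0 v0 uv.
have C1 : 0 <= C / c by rewrite divr_ge0// ltW.
have p2 := prim_dist cgt0 C1 (prim_left0 u0) (prim_left0 v0) p1.
have C2 : 0 <= C / c / c by rewrite divr_ge0// ltW.
have p3 := prim_dist cgt0 C2 (prim_left0 (prim_left0 u0))
   (prim_left0 (prim_left0 v0)) p2.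
have C3 : 0 <= C / c / c / c by rewrite divr_ge0// ltW.
have p4 := prim_dist cgt0 C3 (prim_left0 (prim_left0 (prim_left0 u0)))
   (prim_left0 (prim_left0 (prim_left0 v0))) p3.
have D1 : C / c / c <= C / c.
  by rewrite ler_piMr// (andP ci).2.
have D2 : C / c / c / c <= C / c by rewrite (le_trans _ D1)// ler_piMr// (andP ci).2.
have D3 : C / c / c / c / c <= C / c by rewrite (le_trans _ D2)// ler_piMr// (andP ci).2.
set E := expR (c * x).
have E0 : 0 <= E by exact: expR_ge0.
have q (w w1 w2 D : R) : `|w| <= M -> D <= C / c -> `|w1 - w2| <= D * E ->
    `|w * w1 - w * w2| <= M * (C / c * E).
  move=> h1 h2 h3; rewrite -mulrBr normrM ler_pM// (le_trans h3)//.
  by rewrite ler_wpM2r.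
have -> : K u x - K v x =
  (c0 x * prim (prim (prim (prim u))) x - c0 x * prim (prim (prim (prim v))) x) +
  ((c1 x * prim (prim (prim u)) x - c1 x * prim (prim (prim v)) x) +
   (c2 x * prim (prim u) x - c2 x * prim (prim v) x)).
  by rewrite /K opprD addrACA opprD (addrACA (c1 x * _)).
apply: (@le_trans _ _ (M * (C / c * E) + (M * (C / c * E) + M * (C / c * E)))).
  apply: (le_trans (ler_normD _ _)); apply: lerD; first exact: q (p4 x).
  apply: (le_trans (ler_normD _ _)); apply: lerD; first exact: q (p3 x).
  exact: q (p2 x).
have -> : M * (C / c * E) + (M * (C / c * E) + M * (C / c * E)) =
  (M * 3 * c^-1) * (C * E) by ring.
have -> : C * 2^-1 * E = 2^-1 * (C * E) by ring.
by rewrite ler_wpM2r// mulr_ge0.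
Qed.

Let u_ := fix u_ (n : nat) : R -> R :=
  if n is m.+1 then (fun x => b x + K (u_ m) x) else (fun=> 0).

Let u_0 n : left0 a (u_ n).
Proof.
elim: n => [|n ih]; first exact: left00.
by apply: left0D => //; exact: K0.
Qed.

(** Normalized so that [M <= D * expR (c * x)] to the right of [a], which bounds the first iterate
    in the weighted norm. *)
Let D := M * expR (- c * a).

Let D0 : 0 <= D. Proof. by rewrite mulr_ge0// expR_ge0. Qed.

Let u_step n x : `|u_ n.+1 x - u_ n x| <= D * 2^-1 ^+ n * expR (c * x).
Proof.
elim: n x => [|n ih] x.
  rewrite expr0 mulr1 /=.
  have -> : b x + K (fun=> 0) x - 0 = b x.
    rewrite /K.
    have z y : prim (fun=> 0 : R) y = 0.
      by rewrite /prim /Rintegral integral0_eq.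
    have zz : prim (fun=> 0 : R) = (fun=> 0 : R) by apply/funext => y; exact: z.
    by rewrite !zz !mulr0 !addr0 subr0.
  have [xa|ax] := leP x a.
    by rewrite b0.2// normr0 mulr_ge0 ?expR_ge0.
  rewrite /D -mulrA -expRD (le_trans (bM x))// ler_peMr//.
  by rewrite -expR0 ler_expR mulNr addrC subr_ge0 ler_pM2l// ltW.
have -> : u_ n.+2 x - u_ n.+1 x = K (u_ n.+1) x - K (u_ n) x.
  by rewrite /= opprD addrACA subrr add0r.
rewrite exprSr (mulrA D).
apply: K_dist => //.
by rewrite mulr_ge0// exprn_ge0// invr_ge0.
Qed.

(** The limit of the iterates as a supremum: [u_ n - 2 D 2^-n e^(cx)] increases with [n] and
    [u_ n + 2 D 2^-n e^(cx)] decreases, so this supremum lies between the two for every [n], which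
    is the error bound [u_dist]. *)
Let u (x : R) : R :=
  sup (range (fun n => u_ n x - 2 * D * 2^-1 ^+ n * expR (c * x))).

Let u_dist n x : `|u_ n x - u x| <= 2 * D * 2^-1 ^+ n * expR (c * x).
Proof.
have E0 : 0 <= expR (c * x) by exact: expR_ge0.
set E := expR (c * x) in E0 *.
have h0 m : 0 <= (2^-1 : R) ^+ m by rewrite exprn_ge0// invr_ge0.
have up m : u_ m x - 2 * D * 2^-1 ^+ m * E <= u_ m.+1 x - 2 * D * 2^-1 ^+ m.+1 * E.
  have := u_step m x; rewrite -/E ler_norml => /andP[+ _].
  have -> : 2 * D * 2^-1 ^+ m.+1 * E = D * 2^-1 ^+ m * E.
    by rewrite exprS; field.
  lra.
have dn m : u_ m.+1 x + 2 * D * 2^-1 ^+ m.+1 * E <= u_ m x + 2 * D * 2^-1 ^+ m * E.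
  have := u_step m x; rewrite -/E ler_norml => /andP[_ +].
  have -> : 2 * D * 2^-1 ^+ m.+1 * E = D * 2^-1 ^+ m * E.
    by rewrite exprS; field.
  lra.
have up' i j : u_ i x - 2 * D * 2^-1 ^+ i * E <=
    u_ (i + j)%N x - 2 * D * 2^-1 ^+ (i + j) * E.
  by elim: j => [|j ih]; [rewrite addn0|rewrite addnS (le_trans ih)].
have dn' i j : u_ (i + j)%N x + 2 * D * 2^-1 ^+ (i + j) * E <=
    u_ i x + 2 * D * 2^-1 ^+ i * E.
  by elim: j => [|j ih]; [rewrite addn0|rewrite addnS (le_trans _ ih)].
have ub m : u_ m x - 2 * D * 2^-1 ^+ m * E <= u_ n x + 2 * D * 2^-1 ^+ n * E.
  have := up' m n; have := dn' n m; rewrite (addnC n m).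
  have : 0 <= 2 * D * 2^-1 ^+ (m + n) * E.
    by do 3!rewrite mulr_ge0//.
  lra.
have hs : has_sup (range (fun n => u_ n x - 2 * D * 2^-1 ^+ n * E)).
  split; first by exists (u_ 0%N x - 2 * D * 2^-1 ^+ 0 * E); exists 0%N.
  by exists (u_ n x + 2 * D * 2^-1 ^+ n * E) => _ [m _ <-].
rewrite distrC ler_distl; apply/andP; split.
  by apply: (ub_le_sup hs.2); exists n.
by apply: ge_sup => //; [case: hs|move=> _ [m _ <-]].
Qed.

Let uc : continuous u.
Proof.
move=> x; apply/cvgrPdist_lt => e e0.
pose B := 2 * D * expR (c * (x + 1)) + 1.
have B0 : 0 < B by rewrite ltr_wpDl// mulr_ge0 ?expR_ge0// mulr_ge0.
have := @cvg_geometric R B 2^-1.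
rewrite ger0_norm ?invr_ge0// invf_lt1 ?ltr1n// => /(_ isT).
have e30 : 0 < e / 3 by rewrite divr_gt0.
move=> /cvgrPdist_lt/(_ _ e30)[n _ /(_ n (leqnn n))] /=.
rewrite sub0r normrN => /(le_lt_trans (ler_norm _)) hn.
have bnd y : y <= x + 1 -> `|u_ n y - u y| < e / 3.
  move=> yx; apply: le_lt_trans hn; apply: (le_trans (u_dist n y)).
  rewrite mulrAC ler_wpM2r ?exprn_ge0 ?invr_ge0//.
  rewrite (@le_trans _ _ (2 * D * expR (c * (x + 1))))//; last by rewrite lerDl.
  rewrite ler_wpM2l ?mulr_ge0// ler_expR ler_wpM2l//.
  exact: ltW.
have := (u_0 n).1 x => /cvgrPdist_lt/(_ _ e30) cn.
near=> y.
have yx : y <= x + 1.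
  by apply: ltW; near: y; apply: lt_nbhsl; rewrite ltrDl.
have h1 : `|u_ n x - u_ n y| < e / 3 by near: y.
have h2 := bnd _ yx.
have h3 : `|u_ n x - u x| < e / 3 by apply: bnd; rewrite lerDl.
have -> : u x - u y = (u_ n x - u_ n y) - (u_ n x - u x) + (u_ n y - u y) by ring.
apply: (le_lt_trans (ler_normD _ _)).
have := ler_normB (u_ n x - u_ n y) (u_ n x - u x).
lra.
Unshelve. all: by end_near. Qed.

Let u0 : left0 a u.
Proof.
split=> // x xa; apply/eqP; rewrite -normr_le0.
apply: (@le_of_dvd2 _ _ (2 * D * expR (c * x))) => n.
have := u_dist n x; rewrite (u_0 n).2// sub0r normrN => /le_trans; apply.
by rewrite mulrAC.
Qed.

Let u_eq x : u x = b x + K u x.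
Proof.
apply/eqP; rewrite -subr_eq0 -normr_le0.
apply: (@le_of_dvd2 _ _ (2 * D * expR (c * x))) => n.
have -> : u x - (b x + K u x) = (K (u_ n) x - K u x) - (u_ n.+1 x - u x).
  rewrite [u_ n.+1 x]/=.
  by set p := K _ x; set q := K u x; set r := u x; set s := b x; clearbody p q r s; ring.
apply: (le_trans (ler_normB _ _)).
have C0 : 0 <= 2 * D * 2^-1 ^+ n by rewrite mulr_ge0 ?mulr_ge0// exprn_ge0// invr_ge0.
have := K_dist C0 (u_0 n) u0 (u_dist n) x.
have := u_dist n.+1 x.
set E := expR _.
have -> : 2 * D * 2^-1 ^+ n.+1 * E = 2 * D * 2^-1 ^+ n * 2^-1 * E.
  by rewrite exprS; ring.
lra.
Qed.

Lemma picard : exists2 u : R -> R, left0 a u &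
  forall x, u x = b x + (c0 x * prim (prim (prim (prim u))) x +
    (c1 x * prim (prim (prim u)) x + c2 x * prim (prim u) x)).
Proof. by exists u; [exact: u0|exact: u_eq]. Qed.

End picard.

(** The product form of the hypothesis bounds the slopes on both sides of [x] by [e] and makes no
    differentiability claim. Slopes at most [e] near every point propagate to all of [[s, t]], and
    [e] is arbitrary. *)
Lemma nonincreasing_of_local (R : realType) (F : R -> R) (s t : R) : s <= t ->
  (forall x e, s <= x <= t -> 0 < e ->
    \forall y \near x, (F y - F x) * (y - x) <= e * (y - x) ^+ 2) ->
  F t <= F s.
Proof.
move=> st Floc.
have key e : 0 < e -> F t - F s <= e * (t - s).
  move=> e0.
  (* The left slope bound puts [sup A] into [A]; if [sup A < t], the right slope bound gives a
     larger element. *)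
  pose A := [set x | s <= x <= t /\ F x - F s <= e * (x - s)].
  have As : A s by split; [rewrite lexx st|rewrite !subrr mulr0].
  have Aub : ubound A t by move=> x [/andP[]].
  have hA : has_sup A by split; [exists s|exists t => x []/andP[]].
  set c := sup A.
  have sc : s <= c by exact: (ub_le_sup hA.2).
  have ct : c <= t by apply: ge_sup => //; exists s.
  have cst : s <= c <= t by rewrite sc.
  have /nbhs_ballP[r /= r0 hr] := Floc c e cst e0.
  have right y : c < y < c + r -> F y - F c <= e * (y - c).
    move=> /andP[cy yr]; have /= : ball c r y.
      by rewrite /ball/= ltr_norml; apply/andP; split; lra.
    move=> /hr; rewrite expr2 mulrA ler_pM2r// subr_gt0//.
  have left y : c - r < y < c -> F c - F y <= e * (c - y).
    move=> /andP[yr yc]; have /= : ball c r y.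
      by rewrite /ball/= ltr_norml; apply/andP; split; lra.
    move=> /hr; rewrite expr2 mulrA ler_nM2r ?subr_lt0//.
    by lra.
  have Ac : F c - F s <= e * (c - s).
    have [x Ax xc] := sup_adherent r0 hA.
    have xc' : x <= c by exact: (ub_le_sup hA.2).
    move: xc'; rewrite le_eqVlt => /predU1P[<-|xc']; first by case: Ax.
    have : F c - F x <= e * (c - x) by apply: left; rewrite xc xc'.
    by case: Ax => _; lra.
  move: ct; rewrite le_eqVlt => /predU1P[<-//|ct].
  pose y := Num.min t (c + r / 2).
  have cy : c < y by rewrite lt_min ct/= ltrDl divr_gt0.
  have yr : y < c + r.
    by rewrite gt_min; apply/orP; right; rewrite ltrD2l; lra.
  have Ay : A y.
    split; first by rewrite (le_trans sc (ltW cy)) ge_min lexx.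
    have : F y - F c <= e * (y - c) by apply: right; rewrite cy.
    by lra.
  by have := ub_le_sup hA.2 Ay; rewrite leNgt cy.
rewrite leNgt; apply/negP => Fst.
have [ts|ts] := eqVneq t s; first by move: Fst; rewrite ts ltxx.
have ts0 : 0 < t - s by rewrite subr_gt0 lt_neqAle eq_sym ts.
have := key ((F t - F s) / (2 * (t - s))).
rewrite divr_gt0 ?subr_gt0 ?mulr_gt0// => /(_ isT).
have -> : (F t - F s) / (2 * (t - s)) * (t - s) = (F t - F s) / 2.
  by field; rewrite gt_eqF.
by move: Fst; lra.
Qed.

Lemma continuous_ball (R : realType) (f : R -> R) (x e : R) :
  {for x, continuous f} -> 0 < e ->
  exists2 r, 0 < r & forall y, `|y - x| < r -> `|f y - f x| <= e.
Proof.
move=> fc e0.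
have h : \forall y \near x, `|f x - f y| <= e.
  exact: (@cvgrPdist_le R R R (nbhs x) _ f (f x)).1 fc e e0.
have /nbhs_ballP[r /= r0 hr] := h.
exists r => // y yr.
by rewrite distrC; apply: hr; rewrite /ball/= distrC.
Qed.

Lemma segment_bounded (R : realType) (f : R -> R) (l r : R) : continuous f ->
  exists2 M, 0 <= M & forall x, l <= x <= r -> `|f x| <= M.
Proof.
move=> fc; have [lr|rl] := leP l r; last first.
  by exists 0 => // x /andP[lx xr]; have := lt_le_trans rl (le_trans lx xr); rewrite ltxx.
have [|c _ h] := @EVT_max R (fun x => `|f x|) l r lr.
  apply: continuous_subspaceT => x; apply: continuous_comp (fc x) _.
  exact: norm_continuous.
by exists `|f c| => // x xlr; apply: h; rewrite in_itv.
Qed.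

(** Composition with [clamp l] freezes a coefficient outside [[l, 0]]; a continuous function thereby
    becomes bounded on the line, as [picard] requires. *)
Definition clamp (R : realType) (l x : R) : R := Num.max l (Num.min x 0).

Lemma clamp_continuous (R : realType) (l : R) : continuous (@clamp R l).
Proof.
move=> x; apply: (@continuous_max R R (cst l) (fun x => Num.min x 0)).
  exact: cst_continuous.
apply: (@continuous_min R R id (cst 0)); last exact: cst_continuous.
exact: cvg_id.
Qed.

Lemma clamp_bnd (R : realType) (l x : R) : l <= 0 -> l <= clamp l x <= 0.
Proof. by move=> l0; rewrite /clamp le_max lexx/= ge_max l0 ge_min lexx orbT. Qed.

Lemma clamp_id (R : realType) (l x : R) : l <= x <= 0 -> clamp l x = x.
Proof. by move=> /andP[lx x0]; rewrite /clamp min_l// max_r. Qed.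

Lemma clamp_left (R : realType) (l x : R) : x <= l -> clamp l x = l.
Proof. by move=> xl; rewrite /clamp max_l// ge_min xl. Qed.

Lemma linear_ode4 (R : realType) (l : R) (c0 c1 c2 b : R -> R) : l <= 0 ->
  continuous c0 -> continuous c1 -> continuous c2 -> left0 l b ->
  exists y : nat -> R -> R,
    [/\ forall i, left0 l (y i),
        forall i (x : R), (i < 4)%N -> is_derive x 1 (y i) (y i.+1 x) &
        forall x, x <= 0 ->
          y 4%N x = b x + (c0 x * y 0%N x + (c1 x * y 1%N x + c2 x * y 2%N x))].
Proof.
move=> l0 c0c c1c c2c [bc b0].
have cc (f : R -> R) : continuous f -> continuous (f \o @clamp R l).
  by move=> fc x; exact: (continuous_comp (@clamp_continuous R l x) (fc (clamp l x))).
have [M0 M00 c0M] := segment_bounded l 0 c0c.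
have [M1 M10 c1M] := segment_bounded l 0 c1c.
have [M2 M20 c2M] := segment_bounded l 0 c2c.
have [M3 M30 bM] := segment_bounded l 0 bc.
pose M := M0 + M1 + M2 + M3.
have b0' : left0 l (b \o @clamp R l).
  by split; [exact: cc|move=> x xl; rewrite /= clamp_left// b0].
have [||||u u0 ue] := @picard R l M _ _ _ _ (cc _ c0c) (cc _ c1c) (cc _ c2c) _ _ _ b0' _.
- by move=> x /=; apply: (le_trans (c0M _ (clamp_bnd x l0))); rewrite /M; lra.
- by move=> x /=; apply: (le_trans (c1M _ (clamp_bnd x l0))); rewrite /M; lra.
- by move=> x /=; apply: (le_trans (c2M _ (clamp_bnd x l0))); rewrite /M; lra.
- by move=> x /=; apply: (le_trans (bM _ (clamp_bnd x l0))); rewrite /M; lra.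
have p0 i : left0 l (iter i (@prim R) u) by elim: i => // i ih; exact: prim_left0.
exists (fun i => iter (4 - i) (@prim R) u); split => //.
- move=> i x i4; have -> : (4 - i = (4 - i.+1).+1)%N by rewrite subnSK.
  exact: prim_is_derive (p0 _).
- move=> x x0 /=; rewrite ue /=.
  have [xl|lx] := leP x l; last by rewrite clamp_id// x0 ltW.
  rewrite clamp_left// !b0// -/(iter 4 (@prim R) u) -/(iter 3 (@prim R) u).
  rewrite -/(iter 2 (@prim R) u) (p0 4%N).2// (p0 3%N).2// (p0 2%N).2//.
  by rewrite !mulr0.
Qed.

(** * A Gronwall estimate *)

Definition sqsum4 (R : realType) (z : nat -> R -> R) (x : R) : R :=
  z 0%N x ^+ 2 + (z 1%N x ^+ 2 + (z 2%N x ^+ 2 + z 3%N x ^+ 2)).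

Lemma sqsum4_ge (R : realType) (z : nat -> R -> R) i x : (i < 4)%N ->
  z i x ^+ 2 <= sqsum4 z x.
Proof.
have h j := sqr_ge0 (z j x); rewrite /sqsum4.
by case: i => [|[|[|[|]]]]// _; have := h 0%N; have := h 1%N;
  have := h 2%N; have := h 3%N; lra.
Qed.

(** The source enters only through a primitive [G] of a bound for [h ^+ 2], so the same estimate
    serves for a uniformly small source and for one controlled in L^2. *)
Lemma gronwall4 (R : realType) (l M : R) (c0 c1 c2 h : R -> R)
    (z : nat -> R -> R) (G g : R -> R) : 0 <= M ->
  (forall x, l <= x <= 0 -> [/\ `|c0 x| <= M, `|c1 x| <= M & `|c2 x| <= M]) ->
  (forall i (x : R), (i < 4)%N -> l <= x <= 0 ->
    is_derive x 1 (z i) (z i.+1 x)) ->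
  (forall x, l <= x <= 0 ->
    z 4%N x = h x + (c0 x * z 0%N x + (c1 x * z 1%N x + c2 x * z 2%N x))) ->
  (forall x : R, l <= x <= 0 -> is_derive x 1 G (g x)) ->
  (forall x, l <= x <= 0 -> h x ^+ 2 <= g x) ->
  forall x, l <= x <= 0 ->
    sqsum4 z x <= expR ((3 * M + 2) * (x - l)) * (sqsum4 z l + (G x - G l)).
Proof.
move=> M0 cM dz z4 dG hg x /andP[lx x0].
(* The derivative of [sqsum4 z] is at most [k * sqsum4 z + h ^+ 2]: the coefficient of [z 3 ^+ 2] is
   the largest, with [3 * M] from the three coefficients, 1 from [z 2 * z 3] and 1 from
   [z 3 * h]. *)
set k := 3 * M + 2.
have k0 : 0 <= k by rewrite /k; lra.
pose W t := expR (- k * (t - l)) * sqsum4 z t - G t.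
pose S' t := 2 * (z 0%N t * z 1%N t + (z 1%N t * z 2%N t +
   (z 2%N t * z 3%N t + z 3%N t * z 4%N t))).
pose w t := expR (- k * (t - l)) * (S' t - k * sqsum4 z t) - g t.
have dW t : l <= t <= x -> is_derive t 1 W (w t).
  move=> /andP[lt tx]; have tl : l <= t <= 0 by rewrite lt (le_trans tx).
  have d0 := dz 0%N t isT tl; have d1 := dz 1%N t isT tl.
  have d2 := dz 2%N t isT tl; have d3 := dz 3%N t isT tl.
  have dg := dG t tl.
  have de := pder_expR (pderZ (- k) (pderB (pder_id t) (pder_cst t l))).
  apply: (pder_eq (pderB (pderM de (pderD (pderX 2 d0) (pderD (pderX 2 d1)
    (pderD (pderX 2 d2) (pderX 2 d3))))) dg)).
  rewrite /w /S' /sqsum4 /=; set e := expR _; ring.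
have wle t : l <= t <= x -> w t <= 0.
  move=> /andP[lt tx]; have tl : l <= t <= 0 by rewrite lt (le_trans tx).
  rewrite /w subr_le0.
  apply: le_trans (hg t tl).
  apply: (@le_trans _ _ (expR (- k * (t - l)) * h t ^+ 2)).
    rewrite ler_wpM2l ?expR_ge0// /S' z4//.
    have [a0 a1 a2] := cM t tl.
    have young c p q : `|c| <= M -> 2 * (p * (c * q)) <= M * (p ^+ 2 + q ^+ 2).
      rewrite ler_norml => /andP[h1 h2]; rewrite -subr_ge0.
      have -> : M * (p ^+ 2 + q ^+ 2) - 2 * (p * (c * q)) =
        (M - c) / 2 * (p + q) ^+ 2 + (M + c) / 2 * (p - q) ^+ 2 by field.
      by rewrite addr_ge0// mulr_ge0 ?sqr_ge0//; lra.
    have r (p q : R) : 2 * (p * q) <= p ^+ 2 + q ^+ 2.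
      by rewrite -subr_ge0 (_ : _ - _ = (p - q) ^+ 2) ?sqr_ge0//; ring.
    have := young _ (z 3%N t) (z 0%N t) a0.
    have := young _ (z 3%N t) (z 1%N t) a1.
    have := young _ (z 3%N t) (z 2%N t) a2.
    have := r (z 0%N t) (z 1%N t).
    have := r (z 1%N t) (z 2%N t).
    have := r (z 2%N t) (z 3%N t).
    have := r (z 3%N t) (h t).
    have := mulr_ge0 M0 (sqr_ge0 (z 0%N t)).
    have := mulr_ge0 M0 (sqr_ge0 (z 1%N t)).
    have := mulr_ge0 M0 (sqr_ge0 (z 2%N t)).
    have := sqr_ge0 (z 0%N t).
    have := sqr_ge0 (z 3%N t).
    rewrite /k /sqsum4.
    lra.
  rewrite ler_piMl ?sqr_ge0// -expR0 ler_expR mulNr oppr_le0 mulr_ge0//.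
  by rewrite subr_ge0.
have := derive_le lx dW wle; rewrite mul0r subr_le0 /W.
rewrite subrr mulr0 expR0 mul1r => H.
rewrite -ler_pdivrMl ?expR_gt0// -expRN -mulNr.
by move: H; rewrite -/k; lra.
Qed.

(** * A bump function *)

Section bump.
Variables (R : realType) (x0 e : R).

Lemma pder_maxX n (x : R) : is_derive x 1 (fun t : R => Num.max t 0 ^+ n.+2)
  (n.+2%:R * Num.max x 0 ^+ n.+1).
Proof.
have [x_lt0|x_gt0|->] := ltgtP x 0.
- rewrite expr0n/= mulr0.
  apply: (near_eq_is_derive _ (pder_cst x 0)).
  near=> t; rewrite max_r ?expr0n//; apply: ltW.
  by near: t; exact: lt_nbhsl.
- apply: (near_eq_is_derive _ (pder_eq (pderX n.+2 (pder_id x)) _)).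
    near=> t; rewrite max_l//; apply: ltW.
    by near: t; exact: lt_nbhsr.
  by rewrite mulr1.
- rewrite expr0n/= mulr0.
  (* At the kink the difference quotient of the power is the next lower power, which is continuous
     and vanishes at 0. *)
  apply/is_derive1_caratheodory; exists (fun t => Num.max t 0 ^+ n.+1); split.
  + move=> t; rewrite maxxx expr0n/= !subr0.
    have [t0|t0] := leP t 0; first by rewrite !expr0n/= mul0r.
    by rewrite exprSr.
  + apply: (@continuous_comp _ _ _ (fun t : R => Num.max t 0) (fun t => t ^+ n.+1)).
      apply: (@continuous_max R R id (cst 0)); last exact: cst_continuous.
      exact: cvg_id.
    exact: exprn_continuous.
  + by rewrite maxxx expr0n.
Unshelve. all: by end_near. Qed.

Let v (x : R) : R := Num.max (1 - (e * (x - x0)) ^+ 2) 0.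
Let q (x : R) : R := - (2 * e ^+ 2) * (x - x0).

Let dv n (x : R) :
  is_derive x 1 (fun t => v t ^+ n.+2) (n.+2%:R * v x ^+ n.+1 * q x).
Proof.
have di := pderB (pder_cst x 1) (pderX 2 (pderZ e (pderB (pder_id x) (pder_cst x x0)))).
have dc := @is_derive1_comp _ (fun t => Num.max t 0 ^+ n.+2)
  (fun t => 1 - (e * (t - x0)) ^+ 2) x _ _ (pder_maxX n _) di.
refine (pder_eq dc _).
by congr (_ * _); rewrite /q/=; ring.
Qed.

Let dq (x : R) : is_derive x 1 q (- (2 * e ^+ 2)).
Proof.
apply: pder_eq (pderZ _ (pderB (pder_id x) (pder_cst x x0))) _; ring.
Qed.

(** Only four continuous derivatives are needed, so a power of a truncated parabola suffices: after
    four differentiations every term still contains [v ^+ 2], which is differentiable across the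
    kink. *)
Definition bump (i : nat) (x : R) : R :=
  match i with
  | 0 => v x ^+ 6
  | 1 => 6 * v x ^+ 5 * q x
  | 2 => 30 * v x ^+ 4 * q x ^+ 2 + 6 * - (2 * e ^+ 2) * v x ^+ 5
  | 3 => 120 * v x ^+ 3 * q x ^+ 3 + 90 * - (2 * e ^+ 2) * (v x ^+ 4 * q x)
  | _ => 360 * v x ^+ 2 * q x ^+ 4
         + 720 * - (2 * e ^+ 2) * (v x ^+ 3 * q x ^+ 2)
         + 90 * (2 * e ^+ 2) ^+ 2 * v x ^+ 4
  end.

Lemma bump_derive i (x : R) : (i < 4)%N -> is_derive x 1 (bump i) (bump i.+1 x).
Proof.
have d0 := dv 4 x; have d1 := dv 3 x; have d2 := dv 2 x; have d3 := dv 1 x.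
have d4 := dv 0 x; have dqx := dq x.
case: i => [|[|[|[|//]]]] _.
- by apply: pder_eq d0 _.
- apply: (pder_eq (pderM (pderZ 6 d1) dqx)); rewrite /=.
  move: (v x) (q x) => *; ring.
- apply: (pder_eq (pderD (pderM (pderZ 30 d2) (pderX 2 dqx))
    (pderZ (6 * - (2 * e ^+ 2)) d1))); rewrite /=.
  move: (v x) (q x) => *; ring.
- apply: (pder_eq (pderD (pderM (pderZ 120 d3) (pderX 3 dqx))
    (pderZ (90 * - (2 * e ^+ 2)) (pderM d2 dqx)))); rewrite /=.
  move: (v x) (q x) => *; ring.
Qed.

Lemma bump4_continuous : continuous (bump 4%N).
Proof.
move=> x.
have d4 := dv 0 x; have d3 := dv 1 x; have d2 := dv 2 x; have dqx := dq x.
have h := (pderD (pderD (pderM (pderZ 360 d4) (pderX 4 dqx))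
  (pderZ (720 * - (2 * e ^+ 2)) (pderM d3 (pderX 2 dqx))))
  (pderZ (90 * (2 * e ^+ 2) ^+ 2) d2)).
exact: is_derive_continuous h.
Qed.

Lemma bump_out i x : 1 <= `|e * (x - x0)| -> bump i x = 0.
Proof.
move=> h; have v0 : v x = 0.
  by rewrite /v max_r// subr_le0 -(real_normK (num_real _)) expr_ge1.
by case: i => [|[|[|[|i]]]] /=; rewrite v0 !expr0n/=; ring.
Qed.

Lemma bump_ge0 x : 0 <= bump 0 x.
Proof. by rewrite /= exprn_ge0// le_max lexx orbT. Qed.

Lemma bump_le1 x : bump 0 x <= 1.
Proof.
rewrite /= exprn_ile1//; first by rewrite le_max lexx orbT.
by rewrite ge_max ler01 andbT gerBl sqr_ge0.
Qed.

Lemma bump_in x : `|e * (x - x0)| <= 2^-1 -> (3 / 4) ^+ 6 <= bump 0 x.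
Proof.
move=> h; rewrite /= ler_pXn2r// ?nnegrE ?le_max ?lexx ?orbT//.
apply/orP; left.
have : (e * (x - x0)) ^+ 2 <= 2^-1 ^+ 2.
  by rewrite -(real_normK (num_real (e * _))) ler_pXn2r// nnegrE.
by rewrite expr2 [leRHS]expr2; lra.
Qed.

End bump.

(** * Sobolev functions on the half-line *)

Section half_line_integration.
Variable R : realType.
Implicit Types u v f psi : R -> R.

Lemma half_lineE : half_line R = `]-oo, 0[%classic.
Proof. by apply/seteqP; split => x /=; rewrite /half_line/= in_itv. Qed.

Lemma half_line_open : open (half_line R).
Proof. by rewrite half_lineE; exact: interval_open. Qed.

Lemma half_line_measurable :
  @measurable _ (g_sigma_algebraType R.-ocitv.-measurable) (half_line R).
Proof. by rewrite half_lineE. Qed.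

Lemma half_line_measurable_fun f : (forall x, x < 0 -> {for x, continuous f}) ->
  measurable_fun (half_line R) f.
Proof.
move=> fc; apply: open_continuous_measurable_fun; first exact: half_line_open.
by move=> x /set_mem; exact: fc.
Qed.

Lemma half_line_locally_integrable f :
  (forall x, x < 0 -> {for x, continuous f}) ->
  locally_integrable (half_line R) f.
Proof.
move=> fc; split; [exact: half_line_measurable_fun|exact: half_line_open|].
move=> K KD cK.
have /integrableP[_] : lebesgue_measure.-integrable K (EFin \o f); last by [].
apply: continuous_compact_integrable => //.
by apply: continuous_in_subspaceT => x /set_mem /KD; exact: fc.
Qed.

Lemma Rintegral_supported f (b c : R) : c < 0 ->
  (forall x, f x != 0 -> b <= x <= c) ->
  \int[lebesgue_measure]_(x in half_line R) f x =
  \int[lebesgue_measure]_(x in `[b, c]) f x.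
Proof.
move=> c0 fbc; rewrite Rintegral_mkcond [RHS]Rintegral_mkcond.
apply: eq_Rintegral => x _; rewrite /patch.
have [->|/fbc bxc] := eqVneq (f x) 0; first by rewrite !if_same.
rewrite !mem_set//= ?in_itv//=.
by rewrite /half_line/= (le_lt_trans _ c0)//; case/andP: bxc.
Qed.

Lemma Rintegral_by_parts u v psi : (forall x : R, x < 0 -> is_derive x 1 u (v x)) ->
  (forall x, x < 0 -> {for x, continuous v}) -> test_function psi ->
  \int[lebesgue_measure]_(x in half_line R) (u x * psi^`()%classic x) =
  - \int[lebesgue_measure]_(x in half_line R) (v x * psi x).
Proof.
move=> du cv [psiD [b [c [c0 hbc]]]].
have dpsi (x : R) : is_derive x 1 psi (psi^`()%classic x).
  by have := psiD 0%N x; rewrite derive1n0 => /derivableP; rewrite -derive1E.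
have psi_c : continuous psi by exact: derive_continuous dpsi.
have dpsi_c : continuous psi^`()%classic.
  move=> x; have := psiD 1%N x; rewrite derive1n1 => /derivableP.
  exact: is_derive_continuous.
have out x : ~~ (b <= x <= c) -> psi x = 0.
  by move=> h; apply/eqP; apply: contraNT h; exact: hbc.
have dout x : psi^`()%classic x != 0 -> b <= x <= c.
  apply: contraNT => h; rewrite derive1E; apply/eqP.
  rewrite (_ : 0 = 'D_1 (cst (0 : R)) x); last by rewrite derive_cst.
  apply: near_eq_derive.
  move: h; rewrite negb_and -!ltNge => /orP[xb|cx].
    near=> y; apply: out; rewrite negb_and -!ltNge; apply/orP; left.
    by near: y; exact: lt_nbhsl.
  near=> y; apply: out; rewrite negb_and -!ltNge; apply/orP; right.
  by near: y; exact: lt_nbhsr.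
(* The enlarged interval has endpoints where [psi] vanishes, so there are no boundary terms. The
   minimum keeps [b' < c'] even if [c < b], and [c / 2] stays below 0, where [u] is
   differentiable. *)
pose b' := Num.min b c - 1; pose c' := c / 2.
have cc' : c < c' by rewrite /c'; lra.
have c'0 : c' < 0 by rewrite /c'; lra.
have b'b : b' < b by rewrite /b' ltrBlDr gt_min ltrDl ltr01.
have b'c : b' < c by rewrite /b' ltrBlDr gt_min [c < _]ltrDl ltr01 orbT.
have b'c' : b' < c' by exact: lt_trans b'c cc'.
have wide x : b <= x <= c -> b' <= x <= c'.
  by move=> /andP[h1 h2]; rewrite (le_trans (ltW b'b) h1) (le_trans h2 (ltW cc')).
have pb : psi b' = 0 by apply: out; rewrite negb_and -ltNge b'b.
have pc : psi c' = 0 by apply: out; rewrite negb_and orbC -ltNge cc'.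
rewrite (@Rintegral_supported _ b' c')//; last first.
  by move=> x; rewrite mulf_eq0 negb_or => /andP[_ /dout /wide].
rewrite [in RHS](@Rintegral_supported _ b' c')//; last first.
  by move=> x; rewrite mulf_eq0 negb_or => /andP[_ /hbc /wide].
have neg x : x <= c' -> x < 0 by move=> h; exact: le_lt_trans c'0.
have uc x : x <= c' -> {for x, continuous u}.
  by move=> /neg /du; exact: is_derive_continuous.
rewrite (@Rintegration_by_parts _ u psi v (psi^`()%classic) b' c')//.
- by rewrite pb pc !mulr0 subrr sub0r.
- apply: continuous_in_subspaceT => x /set_mem/=; rewrite in_itv/= => /andP[_ h].
  exact: cv (neg _ h).
- split.
  + by move=> x; rewrite in_itv/= => /andP[_ /ltW /neg /du[]].
  + by apply: cvg_at_right_filter; exact: uc (ltW b'c').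
  + by apply: cvg_at_left_filter; exact: uc.
- move=> x; rewrite in_itv/= => /andP[_ /ltW /neg /du H].
  by rewrite derive1E derive_val.
- exact: continuous_subspaceT.
- split.
  + by move=> x _; case: (dpsi x).
  + by apply: cvg_at_right_filter; exact: psi_c.
  + by apply: cvg_at_left_filter; exact: psi_c.
Unshelve. all: by end_near. Qed.

Lemma weak_derivative_real u v :
  (forall x : R, x < 0 -> is_derive x 1 u (v x)) ->
  (forall x, x < 0 -> {for x, continuous v}) ->
  weak_derivative (fun x => (u x)%:C) (fun x => (v x)%:C).
Proof.
move=> du cv.
have z : locally_integrable (half_line R) (fun=> 0).
  by apply: half_line_locally_integrable => x _; exact: cst_continuous.
split.
- split; last exact: z.
  apply: half_line_locally_integrable => x /du; exact: is_derive_continuous.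
- by split; [exact: half_line_locally_integrable|exact: z].
- move=> psi tpsi; rewrite /cintegral /=.
  under eq_Rintegral do rewrite mulr0 subr0.
  under [X in Complex _ X]eq_Rintegral do rewrite mulr0 mul0r addr0.
  under [X in - Complex X _]eq_Rintegral do rewrite mulr0 subr0.
  under [X in - Complex _ X]eq_Rintegral do rewrite mulr0 mul0r addr0.
  rewrite (Rintegral_by_parts du cv tpsi).
  have -> : \int[lebesgue_measure]_(x in half_line R) (0 : R) = 0.
    by rewrite /Rintegral integral0_eq.
  by apply/eqP; rewrite eq_complex /= oppr0 !eqxx.
Qed.

Lemma expR_integrable (kp : R) : 0 < kp ->
  lebesgue_measure.-integrable (half_line R) (EFin \o (fun x => expR (kp * x))).
Proof.
move=> k0.
have ce : continuous (fun x : R => expR (kp * x)).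
  by move=> x; apply: is_derive_continuous (pder_expR (pderZ kp (pder_id x))).
have ce' : continuous (fun x : R => expR (kp * - x)).
  by move=> x; apply: is_derive_continuous (pder_expR (pderZ kp (pderN (pder_id x)))).
apply/integrableP; split.
  apply/measurable_EFinP; apply: half_line_measurable_fun => x _; exact: ce.
apply: (@le_lt_trans _ _ (\int[lebesgue_measure]_(x in `]-oo, (- 0)%R]) (expR (kp * x))%:E)%E).
  rewrite oppr0.
  under eq_integral do rewrite /= ger0_norm ?expR_ge0//.
  apply: ge0_subset_integral => //.
  - exact: half_line_measurable.
  - apply/measurable_EFinP; apply: measurable_funTS.
    by apply: continuous_measurable_fun.
  - by move=> x /=; rewrite /half_line/= in_itv/= => /ltW.
rewrite ge0_integration_by_substitutionNy; last 2 first.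
- exact: continuous_subspaceT.
- by move=> x _; rewrite expR_ge0.
rewrite (@ge0_continuous_FTC2y _ _ (fun x => - (kp^-1 * expR (kp * - x))) 0 0).
- by rewrite -EFinD ltry.
- by move=> x _; rewrite /= expR_ge0.
- exact: continuous_subspaceT.
- rewrite -[X in _ --> X]oppr0 -[X in _ --> - X](mulr0 kp^-1).
  apply: cvgN; apply: cvgM; first exact: cvg_cst.
  under eq_fun do rewrite mulrN.
  apply: (@cvg_comp _ _ _ (fun x => kp * x) (fun x => expR (- x)) _ (pinfty_nbhs R)).
    exact: gt0_cvgMry.
  exact: cvgr_expR.
- move=> x _.
  by case: (pderN (pderZ kp^-1 (pder_expR (pderZ kp (pderN (pder_id x)))))).
- apply: cvg_at_right_filter.
  exact: is_derive_continuous (pderN (pderZ kp^-1 (pder_expR (pderZ kp (pderN (pder_id 0)))))).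
- move=> x _; have H := pderN (pderZ kp^-1 (pder_expR (pderZ kp (pderN (pder_id x))))).
  by rewrite derive1E derive_val /=; field; rewrite gt_eqF.
Qed.

Lemma Lfun_half_line f (C kp : R) : 0 < kp ->
  (forall x, x < 0 -> {for x, continuous f}) ->
  (forall x, x < 0 -> `|f x| <= C * expR (kp * x)) ->
  f \_ (half_line R) \in Lfun lebesgue_measure 2%:E.
Proof.
move=> k0 fc fC.
have mf := half_line_measurable_fun fc.
apply/andP; split; rewrite inE.
  exact: (measurable_restrictT f half_line_measurable).1 mf.
rewrite /finite_norm unlock /=; apply: poweR_lty.
have k20 : 0 < 2 * kp by rewrite mulr_gt0.
have /integrableP[_] : lebesgue_measure.-integrable (half_line R)
    (EFin \o (fun x => f x ^+ 2)).
  have iE := integrableZl half_line_measurable (C ^+ 2) (expR_integrable k20).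
  apply: (le_integrable half_line_measurable _ _ iE).
    apply/measurable_EFinP; exact: measurable_funX.
  move=> x x0; rewrite /= lee_fin normrX (normrM (C ^+ 2)) normrX.
  have -> : expR (2 * kp * x) = expR (kp * x) ^+ 2.
    by rewrite -expRM_natl; congr expR; ring.
  rewrite (ger0_norm (exprn_ge0 _ (expR_ge0 _))) -exprMn.
  rewrite ler_pXn2r// ?nnegrE ?normr_ge0 ?mulr_ge0 ?expR_ge0//.
  by rewrite (le_trans (fC x x0))// ler_wpM2r ?expR_ge0// ler_norm.
apply: le_lt_trans; rewrite [leRHS]integral_mkcond le_eqVlt; apply/orP; left.
apply/eqP; apply: eq_integral => x _; rewrite /= /patch.
case: ifPn => _; last by rewrite normr0 powR0.
by rewrite /= powR_mulrn// normrX.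
Qed.

Lemma square_integrable_real f (C kp : R) : 0 < kp ->
  (forall x, x < 0 -> {for x, continuous f}) ->
  (forall x, x < 0 -> `|f x| <= C * expR (kp * x)) ->
  square_integrable (fun x => (f x)%:C).
Proof.
move=> k0 fc fC; split; first exact: Lfun_half_line fC.
apply: (@Lfun_half_line (fun=> 0) 0 kp) => // x _; first exact: cst_continuous.
by rewrite normr0 mul0r.
Qed.

End half_line_integration.

(** * Smoothness with weighted bounds on all derivatives *)

Section weighted_smoothness.
Variable R : realType.
Implicit Types (w u v c : R -> R) (n : nat).

Definition wbounded w u : Prop := exists2 C, 0 <= C & forall x, x < 0 -> `|u x| <= C * w x.

(** Used with weight 1 for the density and with weight [e^(kx)] for solutions. The recursion on [n]
    lets products and the bootstrap through the equation go by plain induction. *)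
Fixpoint smoothn w n u : Prop :=
  wbounded w u /\
  (if n is m.+1 then exists2 v, (forall x : R, x < 0 -> is_derive x 1 u (v x)) &
     smoothn w m v else True).

Lemma smoothn_bounded w n u : smoothn w n u -> wbounded w u.
Proof. by case: n => [[]|n []]. Qed.

Lemma smoothnW w n u : smoothn w n.+1 u -> smoothn w n u.
Proof.
elim: n u => [|n ih] u [ub [v du sv]]; first by split.
by split => //; exists v => //; exact: ih.
Qed.

Lemma smoothn_ext w n u v : (forall x, x < 0 -> u x = v x) ->
  smoothn w n u -> smoothn w n v.
Proof.
move=> uv; case: n => [|n] [[C C0 ub] H].
  by split => //; exists C => // x x0; rewrite -uv// ub.
split; first by exists C => // x x0; rewrite -uv// ub.
case: H => u' du su; exists u' => // x x0.
apply: near_eq_is_derive (du x x0); near=> y; apply: uv.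
by near: y; exact: lt_nbhsl.
Unshelve. all: by end_near. Qed.

Lemma smoothnD w n u v : smoothn w n u -> smoothn w n v ->
  smoothn w n (fun x => u x + v x).
Proof.
elim: n u v => [|n ih] u v [[C C0 ub] Hu] [[D D0 vb] Hv].
  split => //; exists (C + D) => [|x x0]; first exact: addr_ge0.
  by rewrite (le_trans (ler_normD _ _))// mulrDl lerD ?ub ?vb.
split.
  exists (C + D) => [|x x0]; first exact: addr_ge0.
  by rewrite (le_trans (ler_normD _ _))// mulrDl lerD ?ub ?vb.
case: Hu => u' du su; case: Hv => v' dv sv.
exists (fun x => u' x + v' x); last exact: ih.
by move=> x x0; exact: pderD (du x x0) (dv x x0).
Qed.

Lemma smoothnM w n c u : (forall x, 0 <= w x) ->
  smoothn (fun=> 1) n c -> smoothn w n u -> smoothn w n (fun x => c x * u x).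
Proof.
move=> w0; have bM c1 u1 : wbounded (fun=> 1) c1 -> wbounded w u1 ->
    wbounded w (fun x => c1 x * u1 x).
  move=> [C C0 ub] [D D0 vb]; exists (C * D); first exact: mulr_ge0.
  move=> x x0; rewrite normrM -mulrA ler_pM// ?vb//.
  by rewrite (le_trans (ub x x0))// mulr1.
elim: n c u => [|n ih] c u hc hu.
  by split => //; apply: bM; [exact: smoothn_bounded hc|exact: smoothn_bounded hu].
split; first by apply: bM; [exact: smoothn_bounded hc|exact: smoothn_bounded hu].
have hc' := smoothnW hc; have hu' := smoothnW hu.
case: hc => _ [c' dc sc]; case: hu => _ [u' du su].
exists (fun x => c' x * u x + c x * u' x).
  by move=> x x0; exact: pderM (dc x x0) (du x x0).
by apply: smoothnD; exact: ih.
Qed.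

Lemma smoothn_cst n (a : R) : smoothn (fun=> 1) n (fun=> a).
Proof.
elim: n a => [|n ih] a; (split; first by exists `|a| => // x _; rewrite mulr1).
  by [].
by exists (fun=> 0) => // x _; exact: pder_cst.
Qed.

Lemma smoothn_continuous w n u x : smoothn w n.+1 u -> x < 0 -> {for x, continuous u}.
Proof. by move=> [_ [v du _]] /du; exact: is_derive_continuous. Qed.

Lemma smoothn_jet w n u : smoothn w n u -> exists d : nat -> R -> R,
  [/\ d 0%N = u, forall j, (j <= n)%N -> smoothn w (n - j) (d j) &
      forall j (x : R), (j < n)%N -> x < 0 -> is_derive x 1 (d j) (d j.+1 x)].
Proof.
elim: n u => [|n ih] u su.
  by exists (fun=> u); split => // j; rewrite leqn0 => /eqP ->.
have [_ [v du sv]] := su; have [d [d0 ds dd]] := ih v sv.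
exists (fun j => if j is i.+1 then d i else u); split => //.
- by case=> [|j]//= jn; rewrite subSS; exact: ds.
- by case=> [|j] x //= jn x0; [rewrite d0; exact: du|exact: dd].
Qed.

(** The order exceeds [m] by one so that the last derivative [d m] is itself differentiable, hence
    continuous and measurable. *)
Lemma smoothn_in_H (kp : R) m u : 0 < kp ->
  smoothn (fun x => expR (kp * x)) m.+1 u -> in_H m (fun x => (u x)%:C).
Proof.
move=> k0 /smoothn_jet[d [d0 ds dd]].
have dc j x : (j <= m)%N -> x < 0 -> {for x, continuous (d j)}.
  by move=> jm /(dd j x (jm : (j < m.+1)%N)); exact: is_derive_continuous.
exists (fun j x => (d j x)%:C); split.
- by rewrite d0; exact: ae_eq_refl.
- move=> j jm; have [|C _ hC] := @smoothn_bounded _ _ _ (ds j _); first exact: leqW.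
  by apply: square_integrable_real k0 _ hC => x; exact: dc.
- move=> j jm; apply: weak_derivative_real => x x0; last exact: dc.
  by apply: dd => //; exact: ltnW.
Qed.

End weighted_smoothness.

(** * The density profile *)

Section density.
Local Open Scope classical_set_scope.
Variables (R : realType) (a rhom rhop : R) (rho0 : R -> R).
Hypothesis hrho : density_assumption a rhom rhop rho0.
Hypothesis a0 : 0 < a.

Lemma at_left_ball (f : R -> R) (L e : R) : f x @[x --> (0 : R)^'-] --> L -> 0 < e ->
  exists2 r, 0 < r & forall x, - r < x < 0 -> `|f x - L| <= e.
Proof.
move=> fL e0; have h : \forall x \near (0 : R)^'-, `|L - f x| <= e.
  exact: (@cvgrPdist_le R R R (0^'-) _ f L).1 fL e e0.
have : nbhs (0 : R) (fun x => x < 0 -> `|L - f x| <= e) by exact: h.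
move=> /nbhs_ballP[r /= r0 hr]; exists r => // x /andP[rx x0].
by rewrite distrC; apply: hr => //; rewrite /ball/= sub0r normrN ltr0_norm// ltrNl.
Qed.

Lemma left_bounded (f : R -> R) (s : R) :
  (forall x, x < 0 -> {for x, continuous f}) -> cvg (f x @[x --> (0 : R)^'-]) ->
  exists2 C, 0 <= C & forall x, s <= x < 0 -> `|f x| <= C.
Proof.
move=> fc /cvg_ex[L fL]; have [r r0 hr] := at_left_ball fL ltr01.
pose r' := Num.min (- s) (r / 2).
have [s0|s0] := leP 0 s.
  by exists 0 => // x /andP[sx x0]; have := le_lt_trans (le_trans s0 sx) x0; rewrite ltxx.
have r'0 : 0 < r' by rewrite lt_min oppr_gt0 s0 divr_gt0.
have sr : s <= - r' by rewrite lerNr ge_min lexx.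
have [|c _ hc] := @EVT_max R (fun x => `|f x|) s (- r') sr.
  apply: continuous_in_subspaceT => x /set_mem/=; rewrite in_itv/= => /andP[_ xr].
  have x0 : x < 0 by rewrite (le_lt_trans xr)// oppr_lt0.
  exact: (continuous_comp (fc x x0) (@norm_continuous _ _ _)).
exists (`|f c| + (`|L| + 1)); first by rewrite !addr_ge0.
move=> x /andP[sx x0]; have [xr|xr] := leP x (- r').
  have := hc x; rewrite in_itv/= sx xr => /(_ isT) h.
  by rewrite (le_trans h)// lerDl addr_ge0.
have xr' : - r < x < 0.
  rewrite x0 andbT (le_lt_trans _ xr)// lerN2 ge_min; apply/orP; right.
  by move: r0; lra.
have := hr x xr'; have := ler_normD (f x - L) L; rewrite subrK.
have := normr_ge0 (f c); lra.
Qed.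

Lemma rho0_derivable n (x : R) : x < 0 ->
  is_derive x 1 (rho0^`(n)) (rho0^`(n.+1) x).
Proof.
have [[rd _ _] _ _ _ _] := hrho.
by move=> x0; have /derivableP := rd n x x0; rewrite derive1nS derive1E.
Qed.

Lemma rho0_left n (x : R) : x < - a -> rho0^`(n) x = if n is 0 then rhom else 0.
Proof.
have [_ _ _ [_ hm] _] := hrho.
elim: n x => [|n ih] x xa; first by rewrite derive1n0 hm// ltW.
rewrite derive1nS derive1E (_ : 0 = 'D_1 (cst (if n is 0 then rhom else 0)) x);
  last by rewrite derive_cst.
apply: near_eq_derive; near=> y; apply: ih.
by near: y; exact: lt_nbhsl.
Unshelve. all: by end_near. Qed.

(** Each derivative is bounded: left of [- a] it is constant, and on [[- a, 0[] it is continuous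
    with a finite limit at 0. *)
Lemma rho0_smoothn n m : smoothn (fun=> 1) m (rho0^`(n)).
Proof.
have [[rd rl _] _ _ _ _] := hrho.
have wb j : wbounded (fun=> 1) (rho0^`(j)).
  have [|C C0 hC] := @left_bounded (rho0^`(j)) (- a) _ (rl j).
    by move=> x /(rho0_derivable j); exact: is_derive_continuous.
  exists (C + `|rhom|); first exact: addr_ge0.
  move=> x x0; rewrite mulr1; have [xa|ax] := ltP x (- a).
    by rewrite rho0_left//; case: j {hC} => *; rewrite ?normr0 ?addr_ge0// lerDr.
  by rewrite (le_trans (hC x _)) ?ax// lerDl.
elim: m n => [|m ih] n; split => //.
by exists (rho0^`(n.+1)) => // x; exact: rho0_derivable.
Qed.

(* rho0' extended past 0 by its left limit. *)
Definition drho (x : R) : R :=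
  if x < 0 then rho0^`() x else lim (rho0^`() x @[x --> (0 : R)^'-]).

Lemma drho_neg x : x < 0 -> drho x = rho0^`() x.
Proof. by rewrite /drho => ->. Qed.

Lemma drho_continuous : continuous drho.
Proof.
have [[_ rl _] _ _ _ _] := hrho.
have := rl 1%N; rewrite derive1n1 => cv.
move=> x; have [x0|x0|->] := ltgtP x 0.
- have := is_derive_continuous (rho0_derivable 1 x0); rewrite derive1n1 => cx.
  rewrite /prop_for /continuous_at (drho_neg x0).
  apply: cvg_trans cx; apply: near_eq_cvg; near=> y.
  by rewrite drho_neg//; near: y; exact: lt_nbhsl.
- apply/cvgrPdist_le => e e0; near=> y.
  have y0 : 0 < y by near: y; exact: lt_nbhsr.
  have E z : 0 < z -> drho z = lim (rho0^`() x @[x --> (0 : R)^'-]).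
    by move=> z0; rewrite /drho ltNge (ltW z0).
  by rewrite !E// subrr normr0 ltW.
- apply/cvgrPdist_le => e e0; have [r r0 hr] := at_left_ball cv e0.
  near=> y; rewrite /drho ltxx; case: ifPn => y0; last by rewrite subrr normr0 ltW.
  rewrite distrC; apply: hr; rewrite y0 andbT.
  by near: y; apply: lt_nbhsr; rewrite oppr_lt0.
Unshelve. all: by end_near. Qed.

Lemma drho_left0 : left0 (- a) drho.
Proof.
split; first exact: drho_continuous.
have lt_case x : x < - a -> drho x = 0.
  move=> xa; rewrite drho_neg; last by rewrite (lt_trans xa)// oppr_lt0.
  by rewrite -derive1n1 (rho0_left 1 xa).
move=> x; rewrite le_eqVlt => /predU1P[->|]; last exact: lt_case.
apply/eqP; rewrite -normr_le0; apply/ler_addgt0Pl => e e0; rewrite addr0.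
have [r r0 hr] := continuous_ball (@drho_continuous (- a)) e0.
have := hr (- a - r / 2); rewrite addrC addKr normrN gtr0_norm ?divr_gt0//.
rewrite lt_case ?gtrBl ?divr_gt0// sub0r normrN; apply.
by move: r0; lra.
Qed.

Lemma drho_ge0 x : x <= 0 -> 0 <= drho x.
Proof.
have [_ rge _ _ _] := hrho.
rewrite le_eqVlt => /predU1P[->|x0]; last by rewrite drho_neg// rge.
apply/ler_addgt0Pl => e e0.
have [r r0 hr] := continuous_ball (@drho_continuous 0) e0.
have h : - (r / 2) < 0 by rewrite oppr_lt0 divr_gt0.
have := hr (- (r / 2)); rewrite subr0 normrN gtr0_norm ?divr_gt0//.
have r2 : r / 2 < r by lra.
move=> /(_ r2); rewrite ler_norml => /andP[_]; have := rge _ h; rewrite -drho_neg//.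
lra.
Qed.

(** Rebuilding the density from [drho] gives a function differentiable on all of R with continuous
    derivative, whatever values [rho0] takes to the right of 0; it agrees with [rho0] up to and
    including 0. *)
Definition rho (x : R) : R := rhom + prim drho x.

Lemma rho_derive (x : R) : is_derive x 1 rho (drho x).
Proof.
apply: pder_eq (pderD (pder_cst x rhom) (prim_is_derive x drho_left0)) _.
exact: add0r.
Qed.

Lemma rho_left x : x <= - a -> rho x = rhom.
Proof. by move=> xa; rewrite /rho (prim_left0 drho_left0).2// addr0. Qed.

Lemma rho_gt0 x : x <= 0 -> 0 < rho x.
Proof.
have [_ _ _ [rm0 _] _] := hrho.
move=> x0; have [xa|ax] := leP x (- a); first by rewrite rho_left.
have := derive_ge (ltW ax) (fun y _ => rho_derive y) (m := 0).
rewrite mul0r (rho_left (lexx (- a))) subr_ge0 => h; apply: (lt_le_trans rm0); apply: h.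
by move=> y /andP[_ yx]; apply: drho_ge0; exact: le_trans x0.
Qed.

Lemma rho_neg x : x < 0 -> rho x = rho0 x.
Proof.
have [_ _ _ [_ hm] _] := hrho.
move=> x0; have [xa|ax] := leP x (- a); first by rewrite rho_left// hm.
have dD (y : R) : - a <= y <= x -> is_derive y 1 (fun y => rho y - rho0 y) 0.
  move=> /andP[_ yx]; have y0 := le_lt_trans yx x0.
  have := rho0_derivable 0 y0; rewrite derive1n0 derive1n1 -drho_neg// => h.
  by apply: pder_eq (pderB (rho_derive y) h) _; exact: subrr.
have h1 := derive_le (ltW ax) dD (fun x _ => lexx 0).
have h2 := derive_ge (ltW ax) dD (fun x _ => lexx 0).
apply/eqP; rewrite -subr_eq0 eq_le.
by move: h1 h2; rewrite !mul0r (rho_left (lexx (- a))) (hm (- a))// subrr subr0 => -> ->.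
Qed.

Lemma rho_0 : rho 0 = rhop.
Proof.
have [[_ _ rc] _ _ _ <-] := hrho.
apply/eqP; rewrite -subr_eq0 -normr_le0; apply/ler_addgt0Pl => e e0; rewrite addr0.
have e2 : 0 < e / 2 by rewrite divr_gt0.
have [r r0 hr] := at_left_ball rc e2.
have [s s0 hs] := continuous_ball (is_derive_continuous (rho_derive 0)) e2.
pose d := Num.min (r / 2) (s / 2).
have d0 : 0 < d by rewrite lt_min !divr_gt0.
have dr : d <= r / 2 by rewrite ge_min lexx.
have ds : d <= s / 2 by rewrite ge_min lexx orbT.
have h0 : - d < 0 by rewrite oppr_lt0.
have := hr (- d); have := hs (- d); rewrite subr0 normrN gtr0_norm// rho_neg// h0 andbT.
rewrite ltrN2 => i1 i2; have {}i1 : `|rho0 (- d) - rho 0| <= e / 2 by apply: i1; lra.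
have {}i2 : `|rho0 (- d) - rho0 0| <= e / 2 by apply: i2; lra.
rewrite (_ : rho 0 - rho0 0 = (rho0 (- d) - rho0 0) - (rho0 (- d) - rho 0)); last by ring.
by rewrite (le_trans (ler_normB _ _))//; lra.
Qed.

(** The closure in the support assumption contains 0, so the set it is taken of cannot be empty. *)
Lemma drho_pos : exists2 x0, - a < x0 < 0 & 0 < drho x0.
Proof.
have [_ rge cl _ _] := hrho.
have [x [x0 dx]] : [set x : R | x < 0 /\ rho0^`() x != 0] !=set0.
  apply/set0P/eqP => E; move: cl; rewrite E closure0 => /esym/seteqP[+ _].
  by move=> /(_ 0) /=; apply; rewrite lexx oppr_le0 ltW.
exists x; last by rewrite drho_neg// lt_neqAle eq_sym dx rge.
rewrite x0 andbT ltNge; apply/negP => xa.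
by move: dx; rewrite -drho_neg// drho_left0.2// eqxx.
Qed.

End density.

(** * Continuity in a parameter, uniform on [[l, 0]] *)

Section uniform_parameter.
Variables (R : realType) (l : R).
Implicit Types (F G : R -> R -> R) (t : R).

(** The bound at [t] is included because products need it. Scalars depending on the parameter are
    treated as functions constant in [x], so the same closure rules cover coefficients, solutions
    and boundary values. *)
Definition ucont F t : Prop :=
  (exists2 B, 0 <= B & forall x, l <= x <= 0 -> `|F t x| <= B) /\
  (forall e, 0 < e ->
    \forall s \near t, forall x, l <= x <= 0 -> `|F s x - F t x| <= e).

Lemma ucontD F G t : ucont F t -> ucont G t ->
  ucont (fun s x => F s x + G s x) t.
Proof.
move=> [[B B0 FB] Fc] [[C C0 GC] Gc]; split.
  exists (B + C) => [|x lx]; first by rewrite addr_ge0.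
  by rewrite (le_trans (ler_normD _ _))// lerD ?FB ?GC.
move=> e e0; have e2 : 0 < e / 2 by rewrite divr_gt0.
near=> s => x lx.
have h1 : `|F s x - F t x| <= e / 2 by move: x lx; near: s; exact: Fc.
have h2 : `|G s x - G t x| <= e / 2 by move: x lx {h1}; near: s; exact: Gc.
rewrite (_ : F s x + G s x - (F t x + G t x) = (F s x - F t x) + (G s x - G t x)); last by ring.
by rewrite (le_trans (ler_normD _ _))//; lra.
Unshelve. all: by end_near. Qed.

Lemma ucontM F G t : ucont F t -> ucont G t ->
  ucont (fun s x => F s x * G s x) t.
Proof.
move=> [[B B0 FB] Fc] [[C C0 GC] Gc]; split.
  exists (B * C) => [|x lx]; first by rewrite mulr_ge0.
  by rewrite normrM ler_pM ?FB ?GC.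
move=> e e0.
pose d := Num.min 1 (e / (B + C + 1)).
have D0 : 0 < B + C + 1 by lra.
have d0 : 0 < d by rewrite lt_min ltr01 divr_gt0.
near=> s => x lx.
have h1 : `|F s x - F t x| <= d by move: x lx; near: s; exact: Fc.
have h2 : `|G s x - G t x| <= d by move: x lx {h1}; near: s; exact: Gc.
rewrite (_ : F s x * G s x - F t x * G t x = (F s x - F t x) * (G s x - G t x)
  + ((F s x - F t x) * G t x + F t x * (G s x - G t x))); last by ring.
have d1 : d <= 1 by rewrite ge_min lexx.
have de : d * (B + C + 1) <= e by rewrite -ler_pdivlMr// ge_min lexx orbT.
have k1 : `|(F s x - F t x) * (G s x - G t x)| <= d * 1.
  by rewrite normrM ler_pM// (le_trans h2).
have k2 : `|(F s x - F t x) * G t x| <= d * C by rewrite normrM ler_pM// GC.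
have k3 : `|F t x * (G s x - G t x)| <= B * d by rewrite normrM ler_pM// FB.
apply: (le_trans (ler_normD _ _)).
have := ler_normD ((F s x - F t x) * G t x) (F t x * (G s x - G t x)).
by lra.
Unshelve. all: by end_near. Qed.

Lemma ucont_param (c : R -> R) t : {for t, continuous c} ->
  ucont (fun s _ => c s) t.
Proof.
move=> cc; split; first by exists `|c t|.
move=> e e0; have {}cc := (@cvgrPdist_le R R R (nbhs t) _ c (c t)).1 cc e e0.
by near=> s => x _; rewrite distrC; near: s; exact: cc.
Unshelve. all: by end_near. Qed.

Lemma ucont_cst (c : R) t : ucont (fun _ _ => c) t.
Proof. by apply: ucont_param; exact: cvg_cst. Qed.

Lemma ucont_fun (f : R -> R) t : continuous f -> ucont (fun _ x => f x) t.
Proof.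
move=> /(segment_bounded l 0)[B B0 fB]; split; first by exists B.
by move=> e e0; near=> s => x _; rewrite subrr normr0 ltW.
Unshelve. all: by end_near. Qed.

Lemma ucont_eval F t x : l <= x <= 0 -> ucont F t ->
  {for t, continuous (fun s => F s x)}.
Proof.
move=> lx [_ Fc]; apply/cvgrPdist_le => e /Fc {}Fc.
by near=> s; rewrite distrC; move: x lx; near: s; exact: Fc.
Unshelve. all: by end_near. Qed.

End uniform_parameter.

(** * The boundary value problem on [[l, 0]], where [l = - a] *)

Section problem.
Variables (R : realType) (g mu k rm l : R) (P p : R -> R).
Hypotheses (g0 : 0 < g) (mu0 : 0 < mu) (k0 : 0 < k) (rm0 : 0 < rm) (l0 : l < 0).
Hypotheses (pl : left0 l p) (dP : forall x : R, is_derive x 1 P (p x)).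
Hypothesis Pl : forall x, x <= l -> P x = rm.
Hypothesis P0 : forall x, l <= x <= 0 -> 0 < P x.
Implicit Types (t s : R) (y z : nat -> R -> R) (f : R -> R).

(* tau > k parametrizes lambda: the two decaying exponentials on (-oo, -a] are
   e^(k x) and e^(tau x). *)
Definition lam t : R := mu * (t ^+ 2 - k ^+ 2) / rm.

(* Here [y i] stands for the i-th derivative of the unknown. *)
Definition Lop (la : R) y (x : R) : R :=
  la ^+ 2 * (k ^+ 2 * P x * y 0%N x - p x * y 1%N x - P x * y 2%N x)
  + la * mu * (y 4%N x - 2 * k ^+ 2 * y 2%N x + k ^+ 4 * y 0%N x)
  - g * k ^+ 2 * p x * y 0%N x.

Definition jet y : Prop :=
  forall i (x : R), (i < 4)%N -> is_derive x 1 (y i) (y i.+1 x).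

Definition solves t f y : Prop :=
  [/\ jet y, continuous (y 4%N) & forall x, x <= 0 -> Lop (lam t) y x = f x].

Definition decays (sg th : R) y : Prop :=
  forall i x, x <= l -> y i x = sg * th ^+ i * expR (th * (x - l)).

Let pc : continuous p := pl.1.

Let Pc : continuous P.
Proof. exact: derive_continuous dP. Qed.

Lemma lam_gt0 t : k < t -> 0 < lam t.
Proof.
move=> kt; rewrite /lam divr_gt0// mulr_gt0// subr_gt0.
by rewrite ltr_pXn2r// nnegrE ltW// (lt_trans k0).
Qed.

Lemma lam_continuous : continuous lam.
Proof.
move=> t; apply: (@is_derive_continuous _ _ _ (mu * (2 * t) / rm)).
have -> : lam = (mu / rm) *: (id ^+ 2 - cst (k ^+ 2)).
  by apply/funext => y; rewrite /lam /= /GRing.scale/= mulrAC.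
apply: is_derive_eq; rewrite /GRing.scale/=; ring.
Qed.

(** [cf0], [cf1] and [cf2] are the coefficients obtained by dividing by [la * mu] and solving for
    the fourth derivative. *)
Definition cf0 (la : R) (x : R) : R :=
  - (la / mu * k ^+ 2 * P x) - k ^+ 4 + g * k ^+ 2 / mu * la^-1 * p x.
Definition cf1 (la : R) (x : R) : R := la / mu * p x.
Definition cf2 (la : R) (x : R) : R := la / mu * P x + 2 * k ^+ 2.

Lemma Lop_solve (la : R) y x (v : R) : 0 < la -> Lop la y x = v <->
  y 4%N x = v / (la * mu) +
    (cf0 la x * y 0%N x + (cf1 la x * y 1%N x + cf2 la x * y 2%N x)).
Proof.
move=> la0; have hm : mu != 0 by rewrite gt_eqF.
have hl : la != 0 by rewrite gt_eqF.
rewrite /Lop /cf0 /cf1 /cf2; split=> [<-|->]; field; exact/andP.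
Qed.

Let contM (f1 f2 : R -> R) : continuous f1 -> continuous f2 ->
  continuous (fun x => f1 x * f2 x).
Proof. by move=> h1 h2 x; apply: cvgM; [exact: h1|exact: h2]. Qed.

Let contD (f1 f2 : R -> R) : continuous f1 -> continuous f2 ->
  continuous (fun x => f1 x + f2 x).
Proof. by move=> h1 h2 x; apply: cvgD; [exact: h1|exact: h2]. Qed.

Let contN (f1 : R -> R) : continuous f1 -> continuous (fun x => - f1 x).
Proof. by move=> h1 x; apply: cvgN; exact: h1. Qed.

Let contC (c : R) : continuous (fun _ : R => c).
Proof. by move=> x; exact: cvg_cst. Qed.

Lemma jet_continuous y i : jet y -> (i < 4)%N -> continuous (y i).
Proof. by move=> jy i4; apply: derive_continuous => x; exact: jy. Qed.

Lemma cf_continuous (la : R) :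
  [/\ continuous (cf0 la), continuous (cf1 la) & continuous (cf2 la)].
Proof.
rewrite /cf0 /cf1 /cf2.
have C (c : R) : continuous (fun _ : R => c) by move=> x; exact: cvg_cst.
split.
- apply: contD; last exact (contM (C _) pc).
  exact (contD (contN (contM (C _) Pc)) (C _)).
- exact (contM (C _) pc).
- exact (contD (contM (C _) Pc) (C _)).
Qed.

Lemma Lop_continuous (la : R) y : jet y -> continuous (y 4%N) ->
  continuous (Lop la y).
Proof.
move=> jy y4; rewrite /Lop.
have y0 := jet_continuous jy (isT : (0 < 4)%N).
have y1 := jet_continuous jy (isT : (1 < 4)%N).
have y2 := jet_continuous jy (isT : (2 < 4)%N).
have C (c : R) : continuous (fun _ : R => c) by move=> x; exact: cvg_cst.
apply: contD; last exact (contN (contM (contM (C _) pc) y0)).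
apply: contD.
  apply: contM (C _) _; apply: contD; last exact (contN (contM Pc y2)).
  exact (contD (contM (contM (C _) Pc) y0) (contN (contM pc y1))).
apply: contM (C _) _; apply: contD; last exact (contM (C _) y0).
exact (contD y4 (contN (contM (C _) y2))).
Qed.

Lemma jetD y z : jet y -> jet z -> jet (fun i x => y i x + z i x).
Proof. by move=> jy jz i x i4; apply: is_deriveD; [exact: jy|exact: jz]. Qed.

Lemma jetZ (c : R) y : jet y -> jet (fun i x => c * y i x).
Proof. by move=> jy i x i4; apply: is_deriveZ; exact: jy. Qed.

Lemma LopD (la : R) y z x :
  Lop la (fun i x => y i x + z i x) x = Lop la y x + Lop la z x.
Proof. by rewrite /Lop; ring. Qed.

Lemma LopZ (la c : R) y x : Lop la (fun i x => c * y i x) x = c * Lop la y x.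
Proof. by rewrite /Lop; ring. Qed.

(** Left of [l] the exponential is an exact solution because [th] is a root of the characteristic
    polynomial; its residual therefore vanishes there and is removed by a solution with zero data.
    With [sg = 1] this continues a decaying exponential to [[l, 0]]; with [sg = 0] it gives a
    particular solution vanishing left of [l]. *)
Lemma exists_solution t th sg f : k < t ->
  (th ^+ 2 - k ^+ 2) * (th ^+ 2 - t ^+ 2) = 0 -> left0 l f ->
  exists y, solves t f y /\ decays sg th y.
Proof.
move=> kt hth [fc f0].
have la0 := lam_gt0 kt; set la := lam t in la0 *.
pose E i x := sg * th ^+ i * expR (th * (x - l)).
have jE : jet E.
  move=> i x _; rewrite /E.
  have -> : (fun x => sg * th ^+ i * expR (th * (x - l))) =
    (sg * th ^+ i) *: (expR \o (fun x => th * (x - l))) by apply/funext.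
  apply: is_derive_eq; rewrite /GRing.scale/= exprS.
  set e := expR _; ring.
have E4 : continuous (E 4%N).
  have -> : E 4%N = fun x => th * E 3%N x.
    by apply/funext => x; rewrite /E (exprS _ 3); ring.
  by apply: contM; [exact: contC|exact: jet_continuous].
have LE x : x <= l -> Lop la E x = 0.
  move=> xl; rewrite /Lop pl.2// Pl// /E.
  set e := expR _.
  have -> : la ^+ 2 * (k ^+ 2 * rm * (sg * th ^+ 0 * e) - 0 * (sg * th ^+ 1 * e)
     - rm * (sg * th ^+ 2 * e)) + la * mu * (sg * th ^+ 4 * e -
     2 * k ^+ 2 * (sg * th ^+ 2 * e) + k ^+ 4 * (sg * th ^+ 0 * e)) -
     g * k ^+ 2 * 0 * (sg * th ^+ 0 * e) =
    la * sg * e * mu * ((th ^+ 2 - k ^+ 2) * (th ^+ 2 - t ^+ 2)).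
    by rewrite /la /lam; field; rewrite gt_eqF.
  by rewrite hth mulr0.
pose b x := (f x - Lop la E x) / (la * mu).
have b0 : left0 l b.
  split; last by move=> x xl; rewrite /b f0// LE// subr0 mul0r.
  apply: contM; last exact: contC.
  by apply: contD => //; apply: contN; exact: Lop_continuous.
have [h0 h1 h2] := cf_continuous la.
have [y [yl jy y4]] := linear_ode4 (ltW l0) h0 h1 h2 b0.
exists (fun i x => E i x + y i x); split; last first.
  by move=> i x xl; rewrite (yl i).2// addr0.
split.
- exact: jetD.
- by apply: contD => //; exact: (yl 4%N).1.
- move=> x x0; rewrite LopD.
  have /(Lop_solve y x (f x - Lop la E x) la0).2 -> := y4 x x0.
  by rewrite addrC subrK.
Qed.

(** * Continuous dependence on tau *)

Lemma ucontN (F : R -> R -> R) t : ucont l F t -> ucont l (fun s x => - F s x) t.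
Proof.
move=> [[B B0 FB] Fc]; split; first by exists B => // x /FB; rewrite normrN.
move=> e /Fc {}Fc; near=> s => x lx; rewrite -opprD normrN.
by move: x lx; near: s.
Unshelve. all: by end_near. Qed.

Let lamV_ucont t : k < t -> ucont l (fun s _ => (lam s)^-1) t.
Proof.
move=> kt; apply: ucont_param; apply: cvgV; last exact: lam_continuous.
by rewrite gt_eqF// lam_gt0.
Qed.

Let lam_ucont t : ucont l (fun s _ => lam s) t.
Proof. by apply: ucont_param; exact: lam_continuous. Qed.

Lemma cf_ucont t : k < t ->
  [/\ ucont l (fun s => cf0 (lam s)) t, ucont l (fun s => cf1 (lam s)) t &
      ucont l (fun s => cf2 (lam s)) t].
Proof.
move=> kt; rewrite /cf0 /cf1 /cf2.
have uC c : ucont l (fun _ _ => c) t by exact: ucont_cst.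
have uL := lam_ucont t; have uV := lamV_ucont kt.
have uP := ucont_fun l t Pc; have up := ucont_fun l t pc.
have uLm := ucontM uL (uC mu^-1).
split.
- apply: ucontD; last exact (ucontM (ucontM (uC _) uV) up).
  apply: ucontD; last exact: uC.
  exact (ucontN (ucontM (ucontM uLm (uC _)) uP)).
- exact (ucontM uLm up).
- exact (ucontD (ucontM uLm uP) (uC _)).
Qed.

(** The [Y s] may be chosen independently for each [s]. The difference [Y s - Y t] solves the
    equation at [s] with a source made of the changes of the coefficients times [Y t], so Gronwall
    reduces continuity to that of the data at [l]. *)
Lemma family_ucont (Y : R -> nat -> R -> R) f t i : continuous f ->
  (forall s, k < s -> solves s f (Y s)) ->
  (forall j, (j < 4)%N -> {for t, continuous (fun s => Y s j l)}) ->
  k < t -> (i < 4)%N -> ucont l (fun s x => Y s i x) t.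
Proof.
move=> fc sY Yl kt i4.
have [jt y4t Lt] := sY _ kt.
have ubY j : (j < 4)%N -> exists2 B, 0 <= B & forall x, l <= x <= 0 -> `|Y t j x| <= B.
  by move=> j4; apply: segment_bounded; exact: jet_continuous.
split; first exact: ubY.
move=> e e0.
have [C0 C00 YC0] := ubY 0%N isT; have [C1 C10 YC1] := ubY 1%N isT.
have [C2 C20 YC2] := ubY 2%N isT.
have [[[B0 B00 cB0] u0] [[B1 B10 cB1] u1] [[B2 B20 cB2] u2]] := cf_ucont kt.
have [_ uf] : ucont l (fun s x => f x * ((lam s)^-1 * mu^-1)) t.
  apply: ucontM; first exact: ucont_fun.
  by apply: ucontM; [exact: lamV_ucont|apply: ucont_param; exact: cvg_cst].
pose M := B0 + B1 + B2 + 1.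
pose E := expR ((3 * M + 2) * - l).
have E0 : 0 <= E by exact: expR_ge0.
pose H := C0 + C1 + C2 + 1.
pose K := E * (4 + H ^+ 2 * - l).
have K0 : 0 <= K.
  by rewrite mulr_ge0// addr_ge0// mulr_ge0 ?sqr_ge0// oppr_ge0 ltW.
(* [d <= 1] keeps the coefficients at [s] below [M]. The source is bounded by [d * H] and the four
   data at [l] by [d], so Gronwall yields [d ^+ 2 * K], which is at most [e ^+ 2]. *)
pose d := Num.min 1 (e / (K + 1)).
have K1 : 0 < K + 1 by rewrite ltr_wpDl.
have d0 : 0 < d by rewrite lt_min ltr01 divr_gt0.
have d1 : d <= 1 by rewrite ge_min lexx.
have dK : d ^+ 2 * K <= e ^+ 2.
  have : d <= e / (K + 1) by rewrite ge_min lexx orbT.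
  rewrite ler_pdivlMr// => de.
  have : (d * (K + 1)) ^+ 2 <= e ^+ 2.
    by rewrite ler_pXn2r// nnegrE ?mulr_ge0// ltW.
  apply: le_trans; rewrite exprMn ler_wpM2l ?sqr_ge0//.
  have -> : (K + 1) ^+ 2 = K ^+ 2 + 2 * K + 1 by ring.
  by have := sqr_ge0 K; lra.
have Yc j : (j < 4)%N -> \forall s \near t, `|Y s j l - Y t j l| <= d.
  move=> j4.
  have cc := (@cvgrPdist_le R R R (nbhs t) _ _ (Y t j l)).1 (Yl j j4) d d0.
  by near=> s; rewrite distrC; near: s; exact: cc.
near=> s => x lx.
have ks : k < s by near: s; exact: lt_nbhsr.
have [js y4s Ls] := sY _ ks.
have n0 : forall x, l <= x <= 0 -> `|cf0 (lam s) x - cf0 (lam t) x| <= d.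
  by near: s; exact: u0.
have n1 : forall x, l <= x <= 0 -> `|cf1 (lam s) x - cf1 (lam t) x| <= d.
  by near: s; exact: u1.
have n2 : forall x, l <= x <= 0 -> `|cf2 (lam s) x - cf2 (lam t) x| <= d.
  by near: s; exact: u2.
have nf : forall x, l <= x <= 0 -> `|f x * ((lam s)^-1 * mu^-1) -
    f x * ((lam t)^-1 * mu^-1)| <= d.
  by near: s; exact: uf.
have i0 : `|Y s 0%N l - Y t 0%N l| <= d by near: s; exact: Yc.
have i1 : `|Y s 1%N l - Y t 1%N l| <= d by near: s; exact: Yc.
have i2 : `|Y s 2%N l - Y t 2%N l| <= d by near: s; exact: Yc.
have i3 : `|Y s 3%N l - Y t 3%N l| <= d by near: s; exact: Yc.
pose z j x := Y s j x - Y t j x.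
pose h x := (f x * ((lam s)^-1 * mu^-1) - f x * ((lam t)^-1 * mu^-1)) +
   ((cf0 (lam s) x - cf0 (lam t) x) * Y t 0%N x +
   ((cf1 (lam s) x - cf1 (lam t) x) * Y t 1%N x +
    (cf2 (lam s) x - cf2 (lam t) x) * Y t 2%N x)).
have M0 : 0 <= M by rewrite !addr_ge0.
have cM x' : l <= x' <= 0 -> [/\ `|cf0 (lam s) x'| <= M, `|cf1 (lam s) x'| <= M &
    `|cf2 (lam s) x'| <= M].
  have tri (u v B : R) : `|u - v| <= d -> `|v| <= B -> B + 1 <= M -> `|u| <= M.
    move=> uv vB BM; rewrite -(subrK v u) (le_trans (ler_normD _ _))//.
    by rewrite (le_trans _ BM)// addrC lerD// (le_trans uv).
  move=> lx'; split.
  - by apply: tri (n0 _ lx') (cB0 _ lx') _; rewrite lerD2r -addrA lerDl addr_ge0.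
  - by apply: tri (n1 _ lx') (cB1 _ lx') _; rewrite lerD2r addrAC lerDr addr_ge0.
  - by apply: tri (n2 _ lx') (cB2 _ lx') _; rewrite lerD2r lerDr addr_ge0.
have dz j (x' : R) : (j < 4)%N -> l <= x' <= 0 -> is_derive x' 1 (z j) (z j.+1 x').
  by move=> j4 _; apply: pderB; [exact: js|exact: jt].
have z4 x' : l <= x' <= 0 -> z 4%N x' = h x' + (cf0 (lam s) x' * z 0%N x' +
   (cf1 (lam s) x' * z 1%N x' + cf2 (lam s) x' * z 2%N x')).
  move=> /andP[_ x0].
  have /(Lop_solve (Y s) x' (f x') (lam_gt0 ks)) e1 := Ls x' x0.
  have /(Lop_solve (Y t) x' (f x') (lam_gt0 kt)) e2 := Lt x' x0.
  rewrite /z e1 e2 /h !invfM.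
  set a1 := cf0 _ _; set a2 := cf1 _ _; set a3 := cf2 _ _.
  set b1 := cf0 _ _; set b2 := cf1 _ _; set b3 := cf2 _ _.
  ring.
have dG (x' : R) : l <= x' <= 0 -> is_derive x' 1 (fun x => (d * H) ^+ 2 * x) ((d * H) ^+ 2).
  move=> _; apply: pder_eq (pderZ _ (pder_id _)) _; exact: mulr1.
have hG x' : l <= x' <= 0 -> h x' ^+ 2 <= (d * H) ^+ 2.
  move=> lx'; rewrite -(real_normK (num_real (h x'))) ler_pXn2r// ?nnegrE ?normr_ge0//.
    rewrite /h.
    have q (u v C : R) : `|u| <= d -> `|v| <= C -> `|u * v| <= d * C.
      by move=> h1 h2; rewrite normrM ler_pM.
    apply: (le_trans (ler_normD _ _)).
    have := nf _ lx'.
    have := q _ _ _ (n0 _ lx') (YC0 _ lx').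
    have := q _ _ _ (n1 _ lx') (YC1 _ lx').
    have := q _ _ _ (n2 _ lx') (YC2 _ lx').
    set w0 := _ * Y t 0%N x'; set w1 := _ * Y t 1%N x'; set w2 := _ * Y t 2%N x'.
    have := ler_normD w0 (w1 + w2); have := ler_normD w1 w2.
    by rewrite /H; lra.
  by rewrite mulr_ge0 ?ltW// /H; lra.
have := gronwall4 M0 cM dz z4 dG hG lx.
have sql (u : R) : `|u| <= d -> u ^+ 2 <= d ^+ 2.
  by move=> ud; rewrite -(real_normK (num_real u)) ler_pXn2r// nnegrE// ltW.
have Sl : sqsum4 z l <= d ^+ 2 * 4.
  have := sql _ i0; have := sql _ i1; have := sql _ i2; have := sql _ i3.
  by rewrite /sqsum4 /z; lra.
move=> hS.
have {}hS : sqsum4 z x <= e ^+ 2.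
  apply: le_trans dK; apply: (le_trans hS).
  rewrite /K mulrCA; apply: ler_pM; first exact: expR_ge0.
  - rewrite addr_ge0//; first by rewrite /sqsum4 !addr_ge0 ?sqr_ge0.
    by rewrite -mulrBr mulr_ge0 ?sqr_ge0// subr_ge0; case/andP: lx.
  - rewrite ler_expR ler_wpM2l ?addr_ge0 ?mulr_ge0//.
    by case/andP: lx => _; lra.
  - rewrite [leRHS]mulrDr; apply: lerD => //.
    rewrite -mulrBr exprMn -mulrA; apply: ler_wpM2l; first exact: sqr_ge0.
    by apply: ler_wpM2l; [exact: sqr_ge0|case/andP: lx => _; lra].
have : z i x ^+ 2 <= e ^+ 2.
  exact: le_trans (sqsum4_ge _ _ i4) hS.
by rewrite -(real_normK (num_real (z i x))) ler_pXn2r// nnegrE ?normr_ge0// ltW.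
Unshelve. all: by end_near. Qed.

(** * Boundary conditions and solvability of the problem with source *)

Definition bc1 y : R := k ^+ 2 * y 0%N 0 + y 2%N 0.

Definition bc2 (la : R) y : R :=
  - (la * mu * y 3%N 0) + (3 * la * mu * k ^+ 2 + la ^+ 2 * P 0) * y 1%N 0
  + g * k ^+ 2 * P 0 * y 0%N 0.

(* The condition at l under which a solution extends to (-oo, l] by a
   combination of the two decaying exponentials. *)
Definition lbc t y : Prop :=
  y 2%N l = (k + t) * y 1%N l - k * t * y 0%N l /\
  y 3%N l = (k + t) * y 2%N l - k * t * y 1%N l.

(** The pair [(s1, s2)] carries the nontriviality, and the formula left of [l] is already the
    decaying extension to the half-line. *)
Definition is_char t : Prop := exists y (s1 s2 : R),
  [/\ s1 != 0 \/ s2 != 0, solves t (fun=> 0) y, bc1 y = 0,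
      bc2 (lam t) y = 0 &
      forall i x, x <= l -> y i x =
        s1 * k ^+ i * expR (k * (x - l)) + s2 * t ^+ i * expR (t * (x - l))].

Lemma exists_family (th : R -> R) (sg : R) f : continuous th ->
  (forall s, (th s ^+ 2 - k ^+ 2) * (th s ^+ 2 - s ^+ 2) = 0) -> left0 l f ->
  exists Y : R -> nat -> R -> R, forall s, k < s ->
    [/\ solves s f (Y s), decays sg (th s) (Y s) &
        forall i, (i < 4)%N -> ucont l (fun s x => Y s i x) s].
Proof.
move=> thc hth f0.
have /choice[Y hY] : forall s, exists y : nat -> R -> R,
    (k < s -> solves s f y /\ decays sg (th s) y) /\
    (forall i, y i l = sg * th s ^+ i).
  move=> s; have [ks|sk] := ltP k s; last first.
    (* For [s <= k] no equation is required; this dummy keeps the formula for the data at [l] valid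
       for all [s], so that its continuity in [s] is evident. *)
    by exists (fun i _ => sg * th s ^+ i).
  have [y [sy dy]] := exists_solution sg ks (hth s) f0.
  by exists y; split => // i; rewrite dy// subrr mulr0 expR0 mulr1.
exists Y => s ks; have [/(_ ks)[h1 h2] _] := hY s; split=> // i i4.
apply: (@family_ucont _ f) => //; first exact: f0.1.
  by move=> t kt; exact: ((hY t).1 kt).1.
move=> j _.
have -> : (fun s => Y s j l) = (fun s => sg * th s ^+ j).
  by apply/funext => t; rewrite (hY t).2.
apply: cvgM; first exact: cvg_cst.
exact: (continuous_comp (thc s) (@exprn_continuous R j (th s))).
Qed.

Lemma ucont_at (F : R -> R -> R) t x0 : l <= x0 <= 0 -> ucont l F t ->
  ucont l (fun s _ => F s x0) t.
Proof. by move=> lx /(ucont_eval lx); exact: ucont_param. Qed.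

Let l00 : l <= (0 : R) <= 0. Proof. by rewrite lexx ltW. Qed.

Let bc1_ucont (Y : R -> nat -> R -> R) t :
  (forall i, (i < 4)%N -> ucont l (fun s x => Y s i x) t) ->
  ucont l (fun s _ => bc1 (Y s)) t.
Proof.
move=> Yu; rewrite /bc1.
have u0 := ucont_at l00 (Yu 0%N isT); have u2 := ucont_at l00 (Yu 2%N isT).
exact (ucontD (ucontM (ucont_cst _ _ _) u0) u2).
Qed.

Let bc2_ucont (Y : R -> nat -> R -> R) t :
  (forall i, (i < 4)%N -> ucont l (fun s x => Y s i x) t) ->
  ucont l (fun s _ => bc2 (lam s) (Y s)) t.
Proof.
move=> Yu; rewrite /bc2.
have u0 := ucont_at l00 (Yu 0%N isT); have u1 := ucont_at l00 (Yu 1%N isT).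
have u3 := ucont_at l00 (Yu 3%N isT).
have uC c : ucont l (fun _ _ => c) t by exact: ucont_cst.
have uL := lam_ucont t.
apply: ucontD; last exact (ucontM (uC _) u0).
apply: ucontD; first exact (ucontN (ucontM (ucontM uL (uC _)) u3)).
apply: ucontM u1; apply: ucontD.
  exact (ucontM (ucontM (ucontM (uC _) uL) (uC _)) (uC _)).
apply: ucontM (uC _).
by have := ucontM uL uL.
Qed.

Let kernel2 (a b c d : R) : a * d - b * c = 0 ->
  exists s1 s2, [/\ s1 != 0 \/ s2 != 0, s1 * a + s2 * b = 0 & s1 * c + s2 * d = 0].
Proof.
move=> D.
have [b0|b0] := eqVneq b 0; last first.
  by exists b, (- a); split; [left| |]; move: D; lra.
have [a0|a0] := eqVneq a 0; last first.
  by exists b, (- a); split; [right; rewrite oppr_eq0| |]; move: D; lra.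
have [d0|d0] := eqVneq d 0; last first.
  by exists d, (- c); split; [left| |]; rewrite ?a0 ?b0; lra.
by exists 0, 1; split; [right; rewrite oner_eq0| |]; rewrite ?b0 ?d0; lra.
Qed.

(** Here [N] stands for any bound of the L^2 norm of [f]. It is essential that [C] be independent of
    [f], because the source will later be concentrated. *)
Lemma particular_bound t : k < t -> exists2 C, 0 <= C & forall f y (N : R),
  left0 l f -> solves t f y -> (forall i, (i < 4)%N -> y i l = 0) ->
  0 <= N -> prim (fun x => f x ^+ 2) 0 <= N ^+ 2 ->
  forall i (x : R), (i < 4)%N -> l <= x <= 0 -> `|y i x| <= C * N.
Proof.
move=> kt; have [[[B0 B00 cB0] _] [[B1 B10 cB1] _] [[B2 B20 cB2] _]] := cf_ucont kt.
have la0 := lam_gt0 kt; set la := lam t in la0 *.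
pose M := B0 + B1 + B2.
have M0 : 0 <= M by rewrite /M; lra.
(* The added 1 makes [1 <= C], so a squared bound by [C * N ^+ 2] is also one by [(C * N) ^+ 2]. *)
pose C := expR ((3 * M + 2) * - l) / (la * mu) ^+ 2 + 1.
have lm : 0 < (la * mu) ^+ 2 by rewrite exprn_gt0// mulr_gt0.
have C1 : 1 <= C by rewrite /C lerDr divr_ge0 ?expR_ge0// ltW.
have C0 : 0 <= C by exact: le_trans C1.
exists C => // f y N f0 [jy _ Ly] yl N0 fN i x i4 lx.
have f20 : left0 l (fun x => f x ^+ 2).
  split; last by move=> x' xl; rewrite f0.2// expr0n.
  by move=> x'; apply: cvgM; exact: f0.1.
pose p2 := prim (fun x => f x ^+ 2).
have dp2 (x' : R) : is_derive x' 1 p2 (f x' ^+ 2) by exact: prim_is_derive f20.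
pose G x := (la * mu) ^- 2 * p2 x.
have dG (x' : R) : l <= x' <= 0 -> is_derive x' 1 G ((la * mu) ^- 2 * f x' ^+ 2).
  by move=> _; exact: pderZ.
have cM x' : l <= x' <= 0 -> [/\ `|cf0 la x'| <= M, `|cf1 la x'| <= M &
    `|cf2 la x'| <= M].
  move=> lx'; have := cB0 _ lx'; have := cB1 _ lx'; have := cB2 _ lx'.
  by rewrite /M -/la => *; split; lra.
have dz j (x' : R) : (j < 4)%N -> l <= x' <= 0 -> is_derive x' 1 (y j) (y j.+1 x').
  by move=> j4 _; exact: jy.
have z4 x' : l <= x' <= 0 -> y 4%N x' = f x' / (la * mu) + (cf0 la x' * y 0%N x' +
   (cf1 la x' * y 1%N x' + cf2 la x' * y 2%N x')).
  by move=> /andP[_ x0]; apply/(Lop_solve _ _ _ la0); exact: Ly.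
have hG x' : l <= x' <= 0 -> (f x' / (la * mu)) ^+ 2 <= (la * mu) ^- 2 * f x' ^+ 2.
  by move=> _; rewrite exprMn exprVn mulrC.
have := gronwall4 M0 cM dz z4 dG hG lx.
have -> : sqsum4 y l = 0 by rewrite /sqsum4 !yl// expr0n/= !addr0.
have /andP[lx1 x0] := lx.
have p2l : p2 l = 0 by exact: (prim_left0 f20).2.
have p2x : p2 x <= N ^+ 2.
  apply: le_trans fN; rewrite -/(p2 0) -subr_ge0.
  have := @derive_ge R p2 (fun x => f x ^+ 2) x 0 0 x0.
  by rewrite mul0r; apply=> x' _; exact: sqr_ge0.
have p20 : 0 <= p2 x.
  have := @derive_ge R p2 (fun x => f x ^+ 2) l x 0 lx1.
  by rewrite mul0r p2l subr0; apply=> x' _; exact: sqr_ge0.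
rewrite add0r /G p2l mulr0 subr0 => hS.
have {}hS : sqsum4 y x <= (C * N) ^+ 2.
  apply: (le_trans hS); rewrite [leRHS]exprMn mulrA; apply: ler_pM => //.
    by rewrite mulr_ge0 ?expR_ge0// invr_ge0 ltW.
  apply: (@le_trans _ _ C); last by rewrite expr2 ler_peMr.
  rewrite /C -[leLHS]addr0; apply: lerD => //.
  apply: ler_wpM2r; first by rewrite invr_ge0 ltW.
  rewrite ler_expR; apply: ler_wpM2l; first by rewrite addr_ge0// mulr_ge0.
  by move: x0; lra.
have : y i x ^+ 2 <= (C * N) ^+ 2.
  exact: le_trans (sqsum4_ge _ _ i4) hS.
rewrite -(real_normK (num_real (y i x))) ler_pXn2r// nnegrE ?normr_ge0//.
exact: mulr_ge0.
Qed.

Definition regular_family (T : R) f (phi : R -> nat -> R -> R) : Prop :=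
  forall t, k < t < T -> [/\ solves t f (phi t), bc1 (phi t) = 0,
    bc2 (lam t) (phi t) = 0, lbc t (phi t) &
    forall i, (i < 4)%N -> ucont l (fun s x => phi s i x) t].

(** The solutions extending decayingly to the left are [Yp + al Y1 + be Y2], and the two conditions
    at 0 form a linear system for [al] and [be]. A zero of its determinant [D] would give a
    combination of [Y1] and [Y2] making [s] characteristic. *)
Lemma solution_family T T' : (forall t, k < t < T -> ~ is_char t) ->
  k < T' < T -> exists2 C, 0 <= C & forall f, left0 l f ->
  exists2 phi, regular_family T f phi &
    forall N : R, 0 <= N -> prim (fun x => f x ^+ 2) 0 <= N ^+ 2 ->
      forall x : R, l <= x <= 0 -> `|phi T' 0%N x| <= C * N.
Proof.
move=> nochar /andP[kT' T'T].
have l0' : left0 l (fun=> 0 : R) by exact: left00.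
have [|s|Y1 hY1] := @exists_family (fun=> k) 1 (fun=> 0) _ _ l0'.
- by move=> s; exact: cvg_cst.
- by rewrite subrr mul0r.
have [|s|Y2 hY2] := @exists_family id 1 (fun=> 0) _ _ l0'.
- by move=> s; exact: cvg_id.
- by rewrite subrr mulr0.
pose b11 s := bc1 (Y1 s); pose b12 s := bc1 (Y2 s).
pose b21 s := bc2 (lam s) (Y1 s); pose b22 s := bc2 (lam s) (Y2 s).
pose D s := b11 s * b22 s - b12 s * b21 s.
have bc1L (c1 c2 : R) y z w : bc1 (fun i x => c1 * y i x + (c2 * z i x + w i x)) =
   c1 * bc1 y + (c2 * bc1 z + bc1 w) by rewrite /bc1; ring.
have bc2L (la c1 c2 : R) y z w :
   bc2 la (fun i x => c1 * y i x + (c2 * z i x + w i x)) =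
   c1 * bc2 la y + (c2 * bc2 la z + bc2 la w) by rewrite /bc2; ring.
have solL s f (c1 c2 : R) w : k < s -> solves s f w ->
    solves s f (fun i x => c1 * Y1 s i x + (c2 * Y2 s i x + w i x)).
  move=> ks [jw w4 Lw].
  have [[j1 y14 L1] _ _] := hY1 _ ks; have [[j2 y24 L2] _ _] := hY2 _ ks.
  split.
  - by apply: jetD; [exact: jetZ|apply: jetD => //; exact: jetZ].
  - apply: contD; first by apply: contM => //; exact: contC.
    by apply: contD => //; apply: contM => //; exact: contC.
  - by move=> x x0; rewrite LopD LopD !LopZ L1// L2// Lw// !mulr0 !add0r.
have D0 s : k < s < T -> D s != 0.
  move=> /[dup] ksT /andP[ks _]; apply/negP => /eqP /kernel2[s1 [s2 [h0 h1 h2]]].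
  apply: (nochar _ ksT).
  exists (fun i x => s1 * Y1 s i x + (s2 * Y2 s i x + 0)), s1, s2.
  split => //.
  - apply: (solL s (fun=> 0) s1 s2 (fun _ _ => 0)) => //; split.
    + by move=> i x _; exact: pder_cst.
    + exact: contC.
    + by move=> x _; rewrite /Lop; ring.
  - by rewrite (bc1L _ _ _ _ (fun _ _ => 0)) {3}/bc1 mulr0 !addr0.
  - by rewrite (bc2L _ _ _ _ _ (fun _ _ => 0)) {3}/bc2 !mulr0 !addr0 oppr0 addr0.
  - move=> i x xl; have [_ d1 _] := hY1 _ ks; have [_ d2 _] := hY2 _ ks.
    by rewrite d1// d2// addr0 !mul1r !mulrA.
have [C C0 hC] := particular_bound kT'.
have ubY Y i : solves T' (fun=> 0) Y -> (i < 4)%N ->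
    exists2 B, 0 <= B & forall x, l <= x <= 0 -> `|Y i x| <= B.
  by move=> [j _ _] i4; apply: segment_bounded; exact: jet_continuous.
have [S1 _ _] := hY1 _ kT'; have [S2 _ _] := hY2 _ kT'.
have [A1 A10 hA1] := ubY _ 0%N S1 isT; have [A2 A20 hA2] := ubY _ 0%N S2 isT.
pose Q1 := (k ^+ 2 + 1) * C.
pose Q2 := (`|lam T' * mu| + `|3 * lam T' * mu * k ^+ 2 + lam T' ^+ 2 * P 0| +
   `|g * k ^+ 2 * P 0|) * C.
have Q10 : 0 <= Q1 by rewrite mulr_ge0// addr_ge0// sqr_ge0.
have Q20 : 0 <= Q2 by rewrite mulr_ge0// !addr_ge0.
pose C' := (Q1 * `|b22 T'| + `|b12 T'| * Q2) / `|D T'| * A1 +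
   ((Q1 * `|b21 T'| + `|b11 T'| * Q2) / `|D T'| * A2 + C).
exists C'.
  by rewrite !addr_ge0// mulr_ge0// divr_ge0// addr_ge0// mulr_ge0.
move=> f f0.
have [|s|Yp hYp] := @exists_family id 0 f _ _ f0.
- by move=> s; exact: cvg_id.
- by rewrite subrr mulr0.
(* Cramer's rule; continuity in [s] follows since [D] is continuous and does not vanish. *)
pose al s := - ((bc1 (Yp s) * b22 s - b12 s * bc2 (lam s) (Yp s)) / D s).
pose be s := (bc1 (Yp s) * b21 s - b11 s * bc2 (lam s) (Yp s)) / D s.
exists (fun s i x => al s * Y1 s i x + (be s * Y2 s i x + Yp s i x)).
- move=> t /[dup] ktT /andP[kt tT]; have Dt := D0 t ktT.
  have [s1 d1 u1] := hY1 _ kt; have [s2 d2 u2] := hY2 _ kt.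
  have [sp dp up] := hYp _ kt.
  split.
  + exact: solL.
  + rewrite bc1L -/(b11 t) -/(b12 t) /al /be.
    by move: Dt; rewrite /D => Dt; field.
  + rewrite bc2L -/(b21 t) -/(b22 t) /al /be.
    by move: Dt; rewrite /D => Dt; field.
  + rewrite /lbc !d1// !d2// !dp// subrr !mulr0 expR0.
    by split; ring.
  + have v1 := bc1_ucont u1; have v2 := bc1_ucont u2; have vp := bc1_ucont up.
    have w1 := bc2_ucont u1; have w2 := bc2_ucont u2; have wp := bc2_ucont up.
    have uDV : ucont l (fun s _ => (D s)^-1) t.
      apply: ucont_param; apply: cvgV => //.
      apply: (@ucont_eval _ l (fun s _ => D s) t 0 l00).
      apply: ucontD; first exact: ucontM.
      by apply: ucontN; exact: ucontM.
    move=> i i4; apply: ucontD.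
      apply: ucontM; last exact: u1.
      apply: ucontN; apply: ucontM => //.
      apply: ucontD; first exact: ucontM.
      by apply: ucontN; exact: ucontM.
    apply: ucontD; last exact: up.
    apply: ucontM; last exact: u2.
    apply: ucontM => //.
    apply: ucontD; first exact: ucontM.
    by apply: ucontN; exact: ucontM.
- move=> N N0 fN x lx.
  have [sp dp up] := hYp _ kT'.
  have dp0 i : (i < 4)%N -> Yp T' i l = 0 by move=> _; rewrite dp// !mul0r.
  have hb := hC f (Yp T') N f0 sp dp0 N0 fN.
  have q1 : `|bc1 (Yp T')| <= Q1 * N.
    apply: (le_trans (ler_normD _ _)).
    rewrite normrM (ger0_norm (sqr_ge0 _)).
    have := hb 2%N 0 isT l00.
    have : k ^+ 2 * `|Yp T' 0%N 0| <= k ^+ 2 * (C * N).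
      by rewrite ler_wpM2l ?sqr_ge0//; exact: hb.
    by rewrite /Q1; lra.
  have q2 : `|bc2 (lam T') (Yp T')| <= Q2 * N.
    apply: (le_trans (ler_normD _ _)).
    rewrite /Q2 -[leRHS]mulrA [leRHS]mulrDl; apply: lerD; last first.
      by rewrite normrM ler_wpM2l//; exact: hb.
    apply: (le_trans (ler_normD _ _)).
    rewrite normrN [leRHS]mulrDl; apply: lerD.
      by rewrite normrM ler_wpM2l//; exact: hb.
    by rewrite normrM ler_wpM2l//; exact: hb.
  have q (u v : R) : `|(bc1 (Yp T') * u - v * bc2 (lam T') (Yp T')) / D T'| <=
      (Q1 * `|u| + `|v| * Q2) / `|D T'| * N.
    rewrite normrM normfV [leRHS]mulrAC; apply: ler_wpM2r; first by rewrite invr_ge0.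
    apply: (le_trans (ler_normB _ _)).
    rewrite [leRHS]mulrDl; apply: lerD; rewrite normrM.
      by rewrite [leRHS]mulrAC; exact: ler_wpM2r.
    by rewrite -[leRHS]mulrA; exact: ler_wpM2l.
  rewrite /C' [leRHS]mulrDl [X in _ <= _ + X]mulrDl.
  apply: (le_trans (ler_normD _ _)); apply: lerD.
    rewrite normrM normrN [leRHS]mulrAC; apply: ler_pM => //; first [exact: q|exact: hA1].
  apply: (le_trans (ler_normD _ _)); apply: lerD; last exact: hb.
  by rewrite normrM [leRHS]mulrAC; apply: ler_pM => //; first [exact: q|exact: hA2].
Qed.

(** * Green's identity and monotonicity in tau *)

Definition Jform (la : R) y z x : R :=
  - (la ^+ 2 * P x * y 1%N x * z 0%N x) + la * mu * (y 3%N x * z 0%N x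
  - y 2%N x * z 1%N x - 3 * k ^+ 2 * y 1%N x * z 0%N x
  - k ^+ 2 * y 0%N x * z 1%N x).

(** The viscous part differs from the more obvious [y'' z'' + 2 k^2 y' z' + k^4 y z] by the exact
    derivative [k^2 (y z)'']. With this choice the conditions at 0 are the natural ones, and the
    part without gravity is a sum of squares on the diagonal. *)
Definition eform (la : R) y z x : R :=
  la ^+ 2 * P x * (k ^+ 2 * y 0%N x * z 0%N x + y 1%N x * z 1%N x)
  + la * mu * ((y 2%N x + k ^+ 2 * y 0%N x) * (z 2%N x + k ^+ 2 * z 0%N x)
  + 4 * k ^+ 2 * y 1%N x * z 1%N x) - g * k ^+ 2 * p x * y 0%N x * z 0%N x.

Lemma Jform_derive (la : R) y z (x : R) : jet y -> jet z ->
  is_derive x 1 (Jform la y z) (Lop la y x * z 0%N x - eform la y z x).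
Proof.
move=> jy jz.
have y0 := jy 0%N x isT; have y1 := jy 1%N x isT; have y2 := jy 2%N x isT.
have y3 := jy 3%N x isT; have z0 := jz 0%N x isT; have z1 := jz 1%N x isT.
have dPx := dP x.
apply: (pder_eq (pderD (pderN (pderM (pderM (pderZ (la ^+ 2) dPx) y1) z0))
  (pderZ (la * mu) (pderB (pderB (pderB (pderM y3 z0) (pderM y2 z1))
    (pderM (pderZ (3 * k ^+ 2) y1) z0)) (pderM (pderZ (k ^+ 2) y0) z1))))).
rewrite /Lop /eform.
move: (y 0%N x) (y 1%N x) (y 2%N x) (y 3%N x) (y 4%N x) (z 0%N x) (z 1%N x)
  (z 2%N x) (P x) (p x) => *.
ring.
Qed.

(** What remains is symmetric in [y] and [z] and independent of [la], so it drops out of the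
    difference of two Green identities. *)
Lemma Jform_right (la : R) y z : bc1 y = 0 -> bc2 la y = 0 ->
  Jform la y z 0 = g * k ^+ 2 * P 0 * y 0%N 0 * z 0%N 0.
Proof.
rewrite /bc1 /bc2 /Jform => h1 h2.
apply/eqP; rewrite -subr_eq0; apply/eqP.
rewrite [LHS](_ : _ = - ((- (la * mu * y 3%N 0)
  + (3 * la * mu * k ^+ 2 + la ^+ 2 * P 0) * y 1%N 0
  + g * k ^+ 2 * P 0 * y 0%N 0) * z 0%N 0)
  - la * mu * z 1%N 0 * (k ^+ 2 * y 0%N 0 + y 2%N 0)); last by ring.
by rewrite h1 h2 !(mul0r, mulr0) subr0 oppr0.
Qed.

Definition nA s t : R := k * (s ^+ 3 + s ^+ 2 * t + s * t ^+ 2 + t ^+ 3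
  + k * (s ^+ 2 + s * t + t ^+ 2) - k ^+ 2 * (s + t) - k ^+ 3).
Definition nB s t : R := s ^+ 2 + s * t + t ^+ 2 + k * (s + t) - k ^+ 2.
Definition nC s t : R := - (k * (s ^+ 2 + s * t + t ^+ 2 - k * (s + t) - k ^+ 2)).

(* Divided difference in tau of the energy of the exterior region (-oo, l],
   as a form in the values of y, y' and z, z' at l. *)
Definition nform s t y z : R := mu ^+ 2 / rm *
  (nA s t * (y 0%N l * z 0%N l) + nB s t * (y 1%N l * z 1%N l)
   + nC s t * (y 1%N l * z 0%N l + y 0%N l * z 1%N l)).

Lemma Jform_left s t y z : lbc t y -> lbc s z ->
  Jform (lam t) y z l - Jform (lam s) z y l = (s - t) * nform s t y z.
Proof.
move=> [y2 y3] [z2 z3]; rewrite /Jform /nform /nA /nB /nC /lam y3 y2 z3 z2 Pl//.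
move: (y 0%N l) (y 1%N l) (z 0%N l) (z 1%N l) => *.
by field; rewrite gt_eqF.
Qed.

(** After multiplication by [t] the mixed term is absorbed by the square of [t a - b] with
    polynomial coefficients. Substituting [t = k + u] turns the cubics multiplying [a ^+ 2] and
    [b ^+ 2] into polynomials in [k] and [u] with positive coefficients. *)
Lemma nform_ge0 t y : k < t -> 0 <= nform t t y y.
Proof.
move=> kt; rewrite /nform mulr_ge0//; first by rewrite divr_ge0 ?sqr_ge0// ltW.
set a := y 0%N l; set b := y 1%N l.
have t0 : 0 < t by exact: lt_trans kt.
rewrite -(pmulr_rge0 _ t0).
pose u := t - k.
have u0 : 0 < u by rewrite subr_gt0.
have -> : t * (nA t t * (a * a) + nB t t * (b * b) + nC t t * (b * a + a * b)) =
  t * (k * (t ^+ 3 + 5 * k * t ^+ 2 - k ^+ 2 * t - k ^+ 3)) * a ^+ 2 +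
  (3 * t ^+ 3 - k * t ^+ 2 + k ^+ 2 * t + k ^+ 3) * b ^+ 2 +
  k * u * (3 * t + k) * (t * a - b) ^+ 2.
  by rewrite /nA /nB /nC /u; ring.
have tE : t = k + u by rewrite /u addrC subrK.
clearbody u.
apply: addr_ge0; [apply: addr_ge0|]; apply: mulr_ge0; rewrite ?sqr_ge0//.
- rewrite mulr_ge0 ?(ltW t0)// mulr_ge0 ?(ltW k0)//.
  have -> : t ^+ 3 + 5 * k * t ^+ 2 - k ^+ 2 * t - k ^+ 3 =
    4 * k ^+ 3 + 12 * k ^+ 2 * u + 8 * k * u ^+ 2 + u ^+ 3.
    by rewrite tE; ring.
  by rewrite !(addr_ge0, mulr_ge0, exprn_ge0)// ?ltW.
- have -> : 3 * t ^+ 3 - k * t ^+ 2 + k ^+ 2 * t + k ^+ 3 =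
    4 * k ^+ 3 + 8 * k ^+ 2 * u + 8 * k * u ^+ 2 + 3 * u ^+ 3.
    by rewrite tE; ring.
  by rewrite !(addr_ge0, mulr_ge0, exprn_ge0)// ?ltW.
- by rewrite !(mulr_ge0, addr_ge0)// ?ltW.
Qed.

(** Divided difference of [eform] in tau, using [lam s - lam t = mu / rm (s + t) (s - t)]. The
    gravity term does not involve [lam] and has disappeared, which leaves squares when [s = t] and
    [z = y]. *)
Definition eslope s t y z x : R := mu / rm * (s + t) *
  ((lam s + lam t) * P x * (k ^+ 2 * y 0%N x * z 0%N x + y 1%N x * z 1%N x) +
   mu * ((y 2%N x + k ^+ 2 * y 0%N x) * (z 2%N x + k ^+ 2 * z 0%N x)
  + 4 * k ^+ 2 * y 1%N x * z 1%N x)).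

Lemma eform_diff s t y z x :
  eform (lam s) z y x - eform (lam t) y z x = (s - t) * eslope s t y z x.
Proof. by rewrite /eform /eslope /lam; field; rewrite gt_eqF. Qed.

Lemma eslope_ge0 t y x : k < t -> l <= x <= 0 -> 0 <= eslope t t y y x.
Proof.
move=> kt lx; have t0 : 0 < t by exact: lt_trans kt.
have la0 := lam_gt0 kt; have Px := P0 lx.
rewrite /eslope mulr_ge0//.
  by rewrite mulr_ge0 ?addr_ge0 ?divr_ge0 ?ltW.
have sq (u : R) : 0 <= u * u by rewrite -expr2 sqr_ge0.
have kk : 0 <= k ^+ 2 by exact: sqr_ge0.
rewrite addr_ge0//.
  rewrite mulr_ge0//; first by rewrite mulr_ge0 ?addr_ge0 ?ltW.
  by rewrite addr_ge0// -mulrA mulr_ge0.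
by rewrite mulr_ge0 ?(ltW mu0)// addr_ge0// -mulrA mulr_ge0// mulr_ge0.
Qed.

Lemma eslope_ucont t (Y : R -> nat -> R -> R) :
  (forall i, (i < 4)%N -> ucont l (fun s x => Y s i x) t) ->
  ucont l (fun s x => eslope s t (Y t) (Y s) x) t.
Proof.
move=> Yu.
have uC (c : R) : ucont l (fun _ _ => c) t by exact: ucont_cst.
have uF i : (i < 4)%N -> ucont l (fun _ x => Y t i x) t.
  by move=> i4; have [[B B0 hB] _] := Yu i i4; split; [exists B|
    move=> e e0; near=> s => x _; rewrite subrr normr0 ltW].
have uid : ucont l (fun s _ => s) t by apply: ucont_param; exact: cvg_id.
have z0 := Yu 0%N isT; have z1 := Yu 1%N isT; have z2 := Yu 2%N isT.
have y0 := uF 0%N isT; have y1 := uF 1%N isT; have y2 := uF 2%N isT.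
have uP := ucont_fun l t Pc; have uL := lam_ucont t.
rewrite /eslope; apply: ucontM; first exact (ucontM (uC _) (ucontD uid (uC _))).
apply: ucontD.
  apply: ucontM; first exact (ucontM (ucontD uL (uC _)) uP).
  exact (ucontD (ucontM (ucontM (uC _) y0) z0) (ucontM y1 z1)).
apply: ucontM; first exact: uC.
apply: ucontD; last exact (ucontM (ucontM (uC _) y1) z1).
exact (ucontM (ucontD y2 (ucontM (uC _) y0)) (ucontD z2 (ucontM (uC _) z0))).
Unshelve. all: by end_near. Qed.

Let ll0 : l <= l <= 0. Proof. by rewrite lexx ltW. Qed.

Lemma nform_ucont t (Y : R -> nat -> R -> R) :
  (forall i, (i < 4)%N -> ucont l (fun s x => Y s i x) t) ->
  ucont l (fun s _ => nform s t (Y t) (Y s)) t.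
Proof.
move=> Yu.
have uC (c : R) : ucont l (fun _ _ => c) t by exact: ucont_cst.
have z0 := ucont_at ll0 (Yu 0%N isT); have z1 := ucont_at ll0 (Yu 1%N isT).
have upol (q : {poly R}) : ucont l (fun s _ => q.[s]) t.
  by apply: ucont_param; exact: continuous_horner.
have uA : ucont l (fun s _ => nA s t) t.
  have := upol (k *: ('X^3 + 'X^2 * t%:P + 'X * (t ^+ 2)%:P + (t ^+ 3)%:P +
    k *: ('X^2 + 'X * t%:P + (t ^+ 2)%:P) - k ^+ 2 *: ('X + t%:P) - (k ^+ 3)%:P)).
  by congr ucont; apply/funext => s; apply/funext => x; rewrite /nA !hornerE.
have uB : ucont l (fun s _ => nB s t) t.
  have := upol ('X^2 + 'X * t%:P + (t ^+ 2)%:P + k *: ('X + t%:P) - (k ^+ 2)%:P).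
  by congr ucont; apply/funext => s; apply/funext => x; rewrite /nB !hornerE.
have uCC : ucont l (fun s _ => nC s t) t.
  have := upol (- (k *: ('X^2 + 'X * t%:P + (t ^+ 2)%:P - k *: ('X + t%:P) - (k ^+ 2)%:P))).
  by congr ucont; apply/funext => s; apply/funext => x; rewrite /nC !hornerE.
rewrite /nform; apply: ucontM; first exact: uC.
apply: ucontD; last exact (ucontM uCC (ucontD (ucontM (uC _) z0) (ucontM (uC _) z1))).
exact (ucontD (ucontM uA (ucontM (uC _) z0)) (ucontM uB (ucontM (uC _) z1))).
Qed.

(** The increment of the response times [s - t] equals minus [(s - t) ^+ 2] times the sum of [nform]
    and the integral of [eslope]. Both are nonnegative at [s = t], hence nearly so for [s] near
    [t]. *)
Lemma response_local T f (phi : R -> nat -> R -> R) t e : left0 l f ->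
  regular_family T f phi -> k < t < T -> 0 < e ->
  \forall s \near t,
    (prim (fun x => f x * phi s 0%N x) 0 - prim (fun x => f x * phi t 0%N x) 0)
    * (s - t) <= e * (s - t) ^+ 2.
Proof.
move=> f0 reg /[dup] ktT /andP[kt tT] e0.
have [[jt y4t Lt] b1t b2t lt ut] := reg t ktT.
have [_ ue] := eslope_ucont ut; have [_ un] := nform_ucont ut.
(* An error [d] is lost once in [nform] and once per unit length of [[l, 0]], in total
   [d * (1 - l) = e]. *)
pose d := e / (1 - l).
have l1 : 0 < 1 - l by rewrite subr_gt0 (lt_trans l0).
have d0 : 0 < d by rewrite divr_gt0.
near=> s.
have ks : k < s by near: s; exact: lt_nbhsr.
have sT : s < T by near: s; exact: lt_nbhsl.
have ksT : k < s < T by rewrite ks.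
have [[js y4s Ls] b1s b2s ls us] := reg s ksT.
have es x : l <= x <= 0 -> - d <= eslope s t (phi t) (phi s) x.
  move=> lx; have := eslope_ge0 (phi t) kt lx.
  have : `|eslope s t (phi t) (phi s) x - eslope t t (phi t) (phi t) x| <= d.
    by move: x lx; near: s; exact: ue.
  by rewrite ler_norml => /andP[+ _]; lra.
have ns : - d <= nform s t (phi t) (phi s).
  have := nform_ge0 (phi t) kt.
  have : forall x, l <= x <= 0 ->
      `|nform s t (phi t) (phi s) - nform t t (phi t) (phi t)| <= d.
    by near: s; exact: un.
  by move=> /(_ 0 l00); rewrite ler_norml => /andP[+ _]; lra.
have fy r : jet (phi r) -> left0 l (fun x => f x * phi r 0%N x).
  move=> jr; split; last by move=> x xl; rewrite f0.2// mul0r.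
  by apply: contM; [exact: f0.1|exact: jet_continuous].
have pd r (x : R) : jet (phi r) -> is_derive x 1 (prim (fun x => f x * phi r 0%N x))
    (f x * phi r 0%N x).
  by move=> jr; exact: prim_is_derive (fy r jr).
(* The factor [s - t] makes the derivative of [W] equal to [(s - t) ^+ 2 * eslope], whose lower
   bound needs no case distinction on the sign of [s - t]. *)
pose W x := (s - t) * (prim (fun x => f x * phi t 0%N x) x -
  prim (fun x => f x * phi s 0%N x) x -
  (Jform (lam s) (phi s) (phi t) x - Jform (lam t) (phi t) (phi s) x)).
have dW (x : R) : l <= x <= 0 ->
    is_derive x 1 W ((s - t) ^+ 2 * eslope s t (phi t) (phi s) x).
  move=> /andP[_ x0].
  apply: (pder_eq (pderZ (s - t) (pderB (pderB (pd t x jt) (pd s x js))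
    (pderB (Jform_derive (lam s) x js jt) (Jform_derive (lam t) x jt js))))).
  rewrite Ls// Lt// expr2 -mulrA -eform_diff; congr (_ * _).
  move: (eform _ _ _ _) (eform _ _ _ _) => *; ring.
have := @derive_ge R W _ l 0 (- ((s - t) ^+ 2 * d)) (ltW l0) dW.
have hb x : l <= x <= 0 ->
    - ((s - t) ^+ 2 * d) <= (s - t) ^+ 2 * eslope s t (phi t) (phi s) x.
  by move=> lx; rewrite -mulrN ler_wpM2l ?sqr_ge0// es.
move=> /(_ hb); clear hb.
have -> : W 0 = - ((prim (fun x => f x * phi s 0%N x) 0 -
    prim (fun x => f x * phi t 0%N x) 0) * (s - t)).
  rewrite /W !Jform_right//.
  move: (prim _ _) (prim _ _) => *; ring.
have -> : W l = (s - t) ^+ 2 * nform s t (phi t) (phi s).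
  rewrite /W (prim_left0 (fy t jt)).2// (prim_left0 (fy s js)).2//.
  by rewrite subrr sub0r opprB Jform_left// mulrA expr2.
have := sqr_ge0 (s - t); set q := (s - t) ^+ 2 => q0.
have : q * - d <= q * nform s t (phi t) (phi s) by rewrite ler_wpM2l.
set w1 := q * nform _ _ _ _; set w2 := _ * (s - t).
have -> : e * q = q * d * (1 - l) by rewrite /d; field; rewrite gt_eqF.
by lra.
Unshelve. all: by end_near. Qed.

(** * The concentrated source and the contradiction *)

Lemma prim_supported h (x0 de K : R) : left0 l h -> l <= x0 - de ->
  x0 + de <= 0 -> 0 <= de ->
  (forall x, de <= `|x - x0| -> h x = 0) ->
  (forall x, l <= x <= 0 -> `|h x| <= K) -> `|prim h 0| <= K * (2 * de).
Proof.
move=> h0 lx x00 de0 hout hK.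
have dh (x : R) : is_derive x 1 (prim h) (h x) by exact: prim_is_derive h0.
have pl0 : prim h l = 0 by exact: (prim_left0 h0).2.
have hz x : x <= x0 - de \/ x0 + de <= x -> h x = 0.
  move=> [H|H]; apply: hout.
    by rewrite ler0_norm; lra.
  by rewrite ger0_norm; lra.
have e1 : prim h (x0 - de) = 0.
  apply/eqP; rewrite eq_le; apply/andP; split.
    have := @derive_le R (prim h) h l (x0 - de) 0 lx (fun x _ => dh x).
    rewrite pl0 subr0 mul0r; apply=> x /andP[_ H]; rewrite hz//; by left.
  have := @derive_ge R (prim h) h l (x0 - de) 0 lx (fun x _ => dh x).
  rewrite pl0 subr0 mul0r; apply=> x /andP[_ H]; rewrite hz//; by left.
have e2 : prim h 0 = prim h (x0 + de).
  apply/eqP; rewrite eq_le -subr_le0 -[X in _ && X]subr_ge0; apply/andP; split.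
    have := @derive_le R (prim h) h (x0 + de) 0 0 x00 (fun x _ => dh x).
    rewrite mul0r; apply=> x /andP[H _]; rewrite hz//; by right.
  have := @derive_ge R (prim h) h (x0 + de) 0 0 x00 (fun x _ => dh x).
  rewrite mul0r; apply=> x /andP[H _]; rewrite hz//; by right.
have st : x0 - de <= x0 + de by lra.
have hK' x : x0 - de <= x <= x0 + de -> - K <= h x <= K.
  by move=> /andP[h1 h2]; rewrite -ler_norml hK//; apply/andP; split; lra.
have := @derive_le R (prim h) h _ _ K st (fun x _ => dh x)
  (fun x H => (andP (hK' x H)).2).
have := @derive_ge R (prim h) h _ _ (- K) st (fun x _ => dh x)
  (fun x H => (andP (hK' x H)).1).
by rewrite e1 -e2 ler_norml => h1 h2; apply/andP; split; lra.
Qed.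

Lemma prim_le_dip h (x0 de K c : R) : left0 l h -> l <= x0 - de ->
  x0 + de <= 0 -> 0 <= de -> (forall x, l <= x <= 0 -> h x <= K) ->
  (forall x, l <= x <= 0 -> `|x - x0| <= de / 2 -> h x <= K - c) ->
  prim h 0 <= K * - l - c * de.
Proof.
move=> h0 lx x00 de0 hK hc.
have dh (x : R) : is_derive x 1 (prim h) (h x) by exact: prim_is_derive h0.
have Hl : prim h l = 0 by exact: (prim_left0 h0).2.
have ord1 : l <= x0 - de / 2 by lra.
have ord2 : x0 - de / 2 <= x0 + de / 2 by lra.
have ord3 : x0 + de / 2 <= 0 by lra.
have j1 : prim h (x0 - de / 2) - prim h l <= K * (x0 - de / 2 - l).
  apply: (derive_le ord1 (fun x _ => dh x)) => x /andP[h1 h2].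
  by apply: hK; rewrite h1 (le_trans h2)// (le_trans ord2).
have j2 : prim h (x0 + de / 2) - prim h (x0 - de / 2) <=
    (K - c) * (x0 + de / 2 - (x0 - de / 2)).
  apply: (derive_le ord2 (fun x _ => dh x)) => x /andP[h1 h2].
  apply: hc; first by rewrite (le_trans ord1)// (le_trans h2).
  by rewrite ler_distl h1.
have j3 : prim h 0 - prim h (x0 + de / 2) <= K * (0 - (x0 + de / 2)).
  apply: (derive_le ord3 (fun x _ => dh x)) => x /andP[h1 h2].
  by apply: hK; rewrite h2 andbT (le_trans _ h1)// (le_trans ord1).
by move: j1 j2 j3; rewrite Hl; lra.
Qed.

Lemma lam_small (T e : R) : k < T -> 0 < e -> exists2 t, k < t < T & lam t <= e.
Proof.
move=> kT e0; have [r r0 hr] := continuous_ball (@lam_continuous k) e0.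
pose w := Num.min (r / 2) ((T - k) / 2).
have w0 : 0 < w by rewrite lt_min !divr_gt0// subr_gt0.
have wr : w <= r / 2 by rewrite ge_min lexx.
have wT : w <= (T - k) / 2 by rewrite ge_min lexx orbT.
exists (k + w); first by rewrite ltrDl w0/=; lra.
have /hr : `|k + w - k| < r by rewrite addrC addKr gtr0_norm//; lra.
rewrite [lam k](_ : _ = 0); last by rewrite /lam subrr mulr0 mul0r.
by rewrite subr0 => /(le_trans (ler_norm _)).
Qed.

Let out_left (x0 de x : R) : l <= x0 - de -> 0 <= de -> x <= l -> de <= `|x - x0|.
Proof. by move=> h1 h2 h3; rewrite ler0_norm; lra. Qed.

Let out_right (x0 de : R) : x0 + de <= 0 -> 0 <= de -> de <= `|0 - x0|.
Proof. by move=> h1 h2; rewrite ger0_norm; lra. Qed.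

(* Both sides are the value of the symmetric form at (y, z). *)
Lemma response_unique t f y z : left0 l f -> solves t f y -> solves t f z ->
  bc1 y = 0 -> bc2 (lam t) y = 0 -> lbc t y ->
  bc1 z = 0 -> bc2 (lam t) z = 0 -> lbc t z ->
  prim (fun x => f x * y 0%N x) 0 = prim (fun x => f x * z 0%N x) 0.
Proof.
move=> f0 [jy y4 Ly] [jz z4 Lz] y1 y2 y3 z1 z2 z3.
have fl w : jet w -> left0 l (fun x => f x * w 0%N x).
  move=> jw; split; last by move=> x xl; rewrite f0.2// mul0r.
  by apply: contM; [exact: f0.1|exact: jet_continuous].
pose W x := prim (fun x => f x * z 0%N x) x - prim (fun x => f x * y 0%N x) x
  - (Jform (lam t) y z x - Jform (lam t) z y x).
have dW (x : R) : l <= x <= 0 -> is_derive x 1 W 0.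
  move=> /andP[_ x0].
  have d1 : is_derive x 1 (prim (fun x => f x * z 0%N x)) (f x * z 0%N x).
    exact: prim_is_derive (fl _ jz).
  have d2 : is_derive x 1 (prim (fun x => f x * y 0%N x)) (f x * y 0%N x).
    exact: prim_is_derive (fl _ jy).
  apply: (pder_eq (pderB (pderB d1 d2) (pderB (Jform_derive (lam t) x jy jz)
    (Jform_derive (lam t) x jz jy)))).
  have -> : eform (lam t) z y x = eform (lam t) y z x by rewrite /eform; ring.
  by rewrite Ly// Lz//; move: (eform _ _ _ _) => *; ring.
have W0 : W 0 = prim (fun x => f x * z 0%N x) 0 - prim (fun x => f x * y 0%N x) 0.
  rewrite /W !Jform_right//.
  move: (prim _ _) (prim _ _) => *; ring.
have Wl : W l = 0.
  rewrite /W (prim_left0 (fl z jz)).2// (prim_left0 (fl y jy)).2//.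
  by rewrite Jform_left// !subrr mul0r subr0.
have h1 := derive_le (ltW l0) dW (fun x _ => lexx 0).
have h2 := derive_ge (ltW l0) dW (fun x _ => lexx 0).
apply/eqP; rewrite eq_sym -subr_eq0 -W0 eq_le.
by move: h1 h2; rewrite !mul0r Wl subr0 => -> ->.
Qed.

Lemma exists_char T x0 : k < T -> l < x0 < 0 -> 0 < p x0 ->
  exists2 t, k < t < T & is_char t.
Proof.
have aux1 (u v : R) : 0 <= u -> u * (v + 1) <= 1 -> u * v <= 1 by lra.
have aux2 (u v w z : R) : 0 <= u * w -> u * (4 * (v + 1) * w) <= z ->
  u * v * w <= z / 4 by lra.
have aux3 (u1 u2 u3 u4 u5 u6 : R) : u1 = u2 -> u3 <= u1 -> u2 <= u5 - u6 ->
  - u4 <= u3 -> u4 <= u6 / 2 -> u5 <= u6 / 4 -> 0 < u6 -> False by lra.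
move=> kT /andP[lx0 x00] px0; apply: contrapT => nex.
have nochar t : k < t < T -> ~ is_char t by move=> h1 h2; apply: nex; exists t.
pose T' := (k + T) / 2.
have kT' : k < T' < T by rewrite /T'; apply/andP; split; lra.
have [C C0 hC] := solution_family nochar kT'.
pose m := p x0 / 2.
have m0 : 0 < m by rewrite divr_gt0.
have [r1 r10 hr1] : exists2 r, 0 < r & forall x, `|x - x0| < r -> m <= p x.
  have [r r0 hr] := continuous_ball (@pc x0) m0.
  exists r => // x /hr; rewrite ler_norml => /andP[+ _].
  by rewrite /m; lra.
have [B B0 hB] := segment_bounded l 0 pc.
have k2 : 0 < k ^+ 2 by rewrite exprn_gt0.
have gk2 : 0 < g * k ^+ 2 by rewrite mulr_gt0.
(* A bound for the source: the gravity term gives [g k^2 B], and the terms carrying [la] will be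
   made at most 1. *)
pose Bf := g * k ^+ 2 * B + 1.
have Bf0 : 0 < Bf by rewrite ltr_wpDl// mulr_ge0// ltW.
(* A lower bound for [psi ^+ 2] on the inner half of its support. *)
pose q : R := ((3 / 4) ^+ 6) ^+ 2.
have q0 : 0 < q by rewrite !exprn_gt0// divr_gt0.
pose c := g * k ^+ 2 * m * q.
have c0 : 0 < c by rewrite !mulr_gt0.
pose rr := Num.min r1 (Num.min (x0 - l) (- x0)).
have rr0 : 0 < rr by rewrite !lt_min r10 subr_gt0 lx0 oppr_gt0.
have rrE : rr <= r1 /\ (rr <= x0 - l /\ rr <= - x0).
  by rewrite !ge_min !lexx !orbT.
clearbody rr.
have BC0 : 0 <= Bf ^+ 2 * C by rewrite mulr_ge0// sqr_ge0.
have BC1 : 0 < 4 * (Bf ^+ 2 * C + 1) by rewrite mulr_gt0// ltr_wpDl.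
(* The support of [psi] will have length [2 * de = eta ^+ 2], so the L^2 norm of the source is at
   most [Bf * eta] without square roots. The last entry of the minimum is what makes the response at
   [T'] smaller than [c * de / 2]. *)
pose eta := Num.min 1 (Num.min rr (c / (4 * (Bf ^+ 2 * C + 1)))).
have eta0 : 0 < eta by rewrite lt_min ltr01/= lt_min rr0/= divr_gt0.
have eta1 : eta <= 1 by rewrite ge_min lexx.
have etar : eta <= rr by rewrite !ge_min lexx !orbT.
have etac : Bf ^+ 2 * C * eta <= c / 4.
  have : eta <= c / (4 * (Bf ^+ 2 * C + 1)) by rewrite !ge_min lexx !orbT.
  by rewrite ler_pdivlMr//; lra.
pose de := eta ^+ 2 / 2.
have de0 : 0 < de by rewrite divr_gt0// exprn_gt0.
have deta : de <= eta / 2.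
  by rewrite ler_pM2r ?invr_gt0// expr2 ler_piMr// ltW.
have [der1 [derl der0]] : de < r1 /\ (l <= x0 - de /\ x0 + de <= 0).
  have : de < rr by lra.
  by move: rrE => [h0 [h1 h2]]; split; [|split]; lra.
pose psi := bump x0 de^-1.
have jpsi : jet psi by move=> i x; exact: bump_derive.
have psi4 : continuous (psi 4%N) by exact: bump4_continuous.
have psi_out i x : de <= `|x - x0| -> psi i x = 0.
  move=> h; apply: bump_out; rewrite normrM gtr0_norm ?invr_gt0//.
  by rewrite ler_pdivlMl// mulr1.
have psi_in x : `|x - x0| <= de / 2 -> (3 / 4) ^+ 6 <= psi 0%N x.
  move=> h; apply: bump_in; rewrite normrM gtr0_norm ?invr_gt0//.
  by rewrite ler_pdivrMl//; lra.
pose a1 x := mu * (psi 4%N x - 2 * k ^+ 2 * psi 2%N x + k ^+ 4 * psi 0%N x).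
pose a2 x := k ^+ 2 * P x * psi 0%N x - p x * psi 1%N x - P x * psi 2%N x.
have cst_c (u : R) : continuous (fun _ : R => u) by move=> x; exact: cvg_cst.
have cpsi i : (i < 4)%N -> continuous (psi i) by exact: jet_continuous.
have p0c := cpsi 0%N isT; have p1c := cpsi 1%N isT; have p2c := cpsi 2%N isT.
have a1c : continuous a1.
  apply: contM (cst_c _) _; apply: contD; last exact (contM (cst_c _) p0c).
  exact (contD psi4 (contN (contM (cst_c _) p2c))).
have a2c : continuous a2.
  apply: contD; last exact (contN (contM Pc p2c)).
  exact (contD (contM (contM (cst_c _) Pc) p0c) (contN (contM pc p1c))).
have [D1 D10 hD1] := segment_bounded l 0 a1c.
have [D2 D20 hD2] := segment_bounded l 0 a2c.
pose D := D1 + D2.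
have D0 : 0 <= D by rewrite addr_ge0.
have l1 : 0 < - l by rewrite oppr_gt0.
have Dl : 0 < 4 * (D + 1) * - l by rewrite !mulr_gt0// ltr_wpDl.
(* [D] depends on the derivatives of [psi], hence on [de], so [t] can be chosen only now. *)
pose ep := Num.min 1 (Num.min (D + 1)^-1 (c * de / (4 * (D + 1) * - l))).
have D1p : 0 < D + 1 by rewrite ltr_wpDl.
have ep0 : 0 < ep by rewrite !lt_min ltr01 invr_gt0 D1p divr_gt0// mulr_gt0.
have [t /andP[kt tT'] lt_ep] := lam_small (andP kT').1 ep0.
have la0 := lam_gt0 kt; set la := lam t in la0 lt_ep.
have la1 : la <= 1 by rewrite (le_trans lt_ep)// ge_min lexx.
have laD : la * D <= 1.
  have : la <= (D + 1)^-1 by rewrite (le_trans lt_ep)// !ge_min lexx orbT.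
  rewrite -[X in _ <= X]mul1r ler_pdivlMr//.
  exact: aux1 (ltW la0).
have laDl : la * D * - l <= c * de / 4.
  have : la <= c * de / (4 * (D + 1) * - l).
    by rewrite (le_trans lt_ep)// !ge_min lexx !orbT.
  rewrite ler_pdivlMr//; apply: aux2.
  by rewrite mulr_ge0// ltW.
pose f := Lop la psi.
have fE x : f x = la ^+ 2 * a2 x + la * a1 x - g * k ^+ 2 * p x * psi 0%N x.
  by rewrite /f /Lop /a1 /a2; ring.
have f_out x : de <= `|x - x0| -> f x = 0.
  by move=> h; rewrite /f /Lop !psi_out//; ring.
have out_l x : x <= l -> de <= `|x - x0|.
  exact: out_left derl (ltW de0).
have f0 : left0 l f.
  by split; [exact: Lop_continuous|move=> x xl; rewrite f_out// out_l].
have rest x : l <= x <= 0 -> `|la ^+ 2 * a2 x + la * a1 x| <= la * D.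
  move=> lx; rewrite (le_trans (ler_normD _ _))//.
  rewrite (normrM (la ^+ 2)) normrX (normrM la (a1 x)) gtr0_norm//.
  rewrite /D mulrDr addrC; apply: lerD.
    by apply: ler_wpM2l; [exact: ltW|exact: hD1].
  apply: ler_pM; rewrite ?exprn_ge0 ?(ltW la0)//; last exact: hD2.
  by rewrite expr2 ler_piMr// ltW.
have psi01 x : 0 <= psi 0%N x <= 1 by rewrite bump_ge0 bump_le1.
have fB x : l <= x <= 0 -> `|f x| <= Bf.
  move=> lx; rewrite fE (le_trans (ler_normB _ _))// /Bf addrC lerD//.
    rewrite normrM (normrM (g * k ^+ 2) (p x)) (gtr0_norm gk2).
    have /andP[h1 h2] := psi01 x; rewrite (ger0_norm h1).
    rewrite -[leRHS]mulr1; apply: ler_pM => //; first by rewrite mulr_ge0// ltW.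
    by rewrite ler_pM2l// hB.
  exact: le_trans (rest x lx) laD.
have [phi reg phib] := hC f f0.
have ktT : k < t < T by rewrite kt (lt_trans tT')//; case/andP: kT'.
have [st b1 b2 lb ut] := reg t ktT.
have pl0 i : psi i l = 0 by rewrite psi_out// out_l.
have p00 i : psi i 0 = 0 by rewrite psi_out// (out_right der0)// ltW.
(* [psi] vanishes with its derivatives near [l] and at 0, so it satisfies all boundary conditions
   and solves the problem with its own source [f]; the response at [t] is therefore the quadratic
   form at [psi]. *)
have S1 : prim (fun x => f x * phi t 0%N x) 0 = prim (fun x => f x * psi 0%N x) 0.
  apply: (response_unique f0 st) => //.
  - by rewrite /bc1 !p00; ring.
  - by rewrite /bc2 !p00; ring.
  - by rewrite /lbc !pl0; split; ring.
have S2 : prim (fun x => f x * phi T' 0%N x) 0 <= prim (fun x => f x * phi t 0%N x) 0.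
  apply: (@nonincreasing_of_local R (fun s => prim (fun x => f x * phi s 0%N x) 0)).
    exact: ltW.
  move=> s e /andP[ts sT'] e0; apply: (response_local f0 reg) => //.
  by rewrite (lt_le_trans kt ts) (le_lt_trans sT')//; case/andP: kT'.
have fpsi : left0 l (fun x => f x * psi 0%N x).
  split; last by move=> x xl; rewrite f0.2// mul0r.
  by apply: contM => //; exact: f0.1.
have S3 : prim (fun x => f x * psi 0%N x) 0 <= la * D * - l - c * de.
  have ub x : l <= x <= 0 -> f x * psi 0%N x <= la * D - g * k ^+ 2 * (p x * psi 0%N x ^+ 2).
    move=> lx; rewrite fE.
    rewrite [leLHS](_ : _ = (la ^+ 2 * a2 x + la * a1 x) * psi 0%N x -
       g * k ^+ 2 * (p x * psi 0%N x ^+ 2)); last by ring.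
    rewrite lerB//; have := rest x lx; rewrite ler_norml => /andP[_ h].
    have /andP[h1 h2] := psi01 x.
    rewrite -[leRHS]mulr1; apply: (@le_trans _ _ (la * D * psi 0%N x)).
      by rewrite ler_wpM2r.
    by rewrite ler_wpM2l// mulr_ge0// ltW.
  have ub1 x : l <= x <= 0 -> f x * psi 0%N x <= la * D.
    move=> lx; rewrite (le_trans (ub x lx))// gerBl mulr_ge0 ?(ltW gk2)//.
    have [H|H] := leP de `|x - x0|; first by rewrite psi_out// expr0n mulr0.
    by rewrite mulr_ge0 ?sqr_ge0// (le_trans (ltW m0))// hr1// (lt_trans H).
  apply: prim_le_dip fpsi derl der0 (ltW de0) ub1 _ => x lx H.
  rewrite (le_trans (ub x lx))// lerB// /c -mulrA ler_pM2l//.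
  apply: ler_pM; [exact: ltW|exact: ltW| |].
    apply: hr1; rewrite (le_lt_trans H)// (le_lt_trans _ der1)//.
    by rewrite ler_pdivrMr// ler_peMr ?ler1n// ltW.
  have h34 : 0 <= (3 / 4 : R) ^+ 6 by rewrite exprn_ge0// divr_ge0.
  rewrite ler_pXn2r//; first exact: psi_in.
  by rewrite nnegrE; case/andP: (psi01 x).
have f20 : left0 l (fun x => f x ^+ 2).
  split; last by move=> x xl; rewrite f0.2// expr0n.
  by apply: contM; exact: f0.1.
have de2 : 2 * de = eta ^+ 2 by rewrite /de; field.
have S4 : prim (fun x => f x ^+ 2) 0 <= (Bf * eta) ^+ 2.
  apply: (le_trans (ler_norm _)).
  rewrite exprMn -de2; apply: (@prim_supported _ x0 de) => //; first exact: ltW.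
    by move=> x h; rewrite f_out// expr0n.
  by move=> x lx; rewrite normrX ler_pXn2r// ?nnegrE ?normr_ge0 ?fB// ltW.
have N0 : 0 <= Bf * eta by rewrite mulr_ge0// ltW.
have S5 := phib _ N0 S4.
have [jT _ _] : solves T' f (phi T') by have [] := reg T' kT'.
have fphi : left0 l (fun x => f x * phi T' 0%N x).
  split; last by move=> x xl; rewrite f0.2// mul0r.
  by apply: contM; [exact: f0.1|exact: jet_continuous].
have S6 : `|prim (fun x => f x * phi T' 0%N x) 0| <= Bf * (C * (Bf * eta)) * (2 * de).
  apply: (@prim_supported _ x0 de) => //; first exact: ltW.
    by move=> x h; rewrite f_out// mul0r.
  by move=> x lx; rewrite normrM ler_pM// ?fB// S5.
have S7 : Bf * (C * (Bf * eta)) * (2 * de) <= c * de / 2.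
  rewrite [leLHS](_ : _ = (Bf ^+ 2 * C * eta) * (2 * de)); last by ring.
  rewrite [leRHS](_ : _ = c / 4 * (2 * de)); last by field.
  by rewrite ler_wpM2r// mulr_ge0// ltW.
have cde : 0 < c * de by rewrite mulr_gt0.
move: S6; rewrite ler_norml => /andP[S6 _].
(* The chain reads [- c de / 2 <= response at T' <= response at t <= c de / 4 - c de]. *)
exact: aux3 S1 S2 S3 S6 S7 laDl cde.
Qed.

(** * From a characteristic tau to a solution on the half-line *)

Section characteristic.
Variables (rho0 : R -> R) (rhop : R).
Hypotheses (P_rho : forall x, x < 0 -> P x = rho0 x) (P_rhop : P 0 = rhop).
Hypothesis p_rho : forall x, x < 0 -> p x = (rho0^`())%classic x.
Hypothesis rho_smooth : forall n m, smoothn (fun=> 1) m (rho0^`(n))%classic.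
Variables (t : R) (y : nat -> R -> R) (s1 s2 : R).
Hypotheses (kt : k < t) (sy : solves t (fun=> 0) y).
Hypotheses (y1 : bc1 y = 0) (y2 : bc2 (lam t) y = 0) (s12 : s1 != 0 \/ s2 != 0).
Hypothesis yl : forall i x, x <= l -> y i x =
  s1 * k ^+ i * expR (k * (x - l)) + s2 * t ^+ i * expR (t * (x - l)).

Let E x := expR (k * x).

(** Left of [l] both exponentials are dominated by [e^(k (x - l))] because [k < t]; on [[l, 0]]
    continuity suffices. *)
Let y_bound i : (i <= 4)%N -> wbounded E (y i).
Proof.
move=> i4; have yc : continuous (y i).
  case: sy => jy y4 _; move: i4; rewrite leq_eqVlt => /predU1P[->//|i4].
  exact: jet_continuous.
have [B B0 hB] := segment_bounded l 0 yc.
pose D := `|s1 * k ^+ i| + `|s2 * t ^+ i|.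
have D0 : 0 <= D by rewrite addr_ge0.
have el : 0 <= expR (- (k * l)) by exact: expR_ge0.
have eE x : expR (- (k * l)) * E x = expR (k * (x - l)).
  by rewrite /E -expRD; congr expR; ring.
exists ((B + D) * expR (- (k * l))) => [|x x0]; first by rewrite mulr_ge0// addr_ge0.
rewrite -mulrA eE; have [xl|lx] := leP x l.
  rewrite yl// (le_trans (ler_normD _ _))// !normrM !(ger0_norm (expR_ge0 _)).
  apply: (@le_trans _ _ (D * expR (k * (x - l)))); last first.
    by rewrite ler_wpM2r ?expR_ge0// lerDr.
  rewrite /D mulrDl !normrM lerD2l ler_wpM2l ?mulr_ge0// ler_expR.
  by rewrite ler_wnM2r// ?subr_le0// ltW.
rewrite (le_trans (hB x _)) ?(ltW lx) ?(ltW x0)//.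
rewrite -[leLHS]mulr1; apply: ler_pM => //; first by rewrite lerDl.
by rewrite -expR0 ler_expR mulr_ge0 ?(ltW k0)// subr_ge0 ltW.
Qed.

Let y_derive i (x : R) : (i < 4)%N -> is_derive x 1 (y i) (y i.+1 x).
Proof. by case: sy => jy _ _; exact: jy. Qed.

Let rho_smoothn n : smoothn (fun=> 1) n rho0.
Proof. exact: (rho_smooth 0). Qed.

Let drho_smoothn n : smoothn (fun=> 1) n (rho0^`())%classic.
Proof. exact: (rho_smooth 1). Qed.

(** Bootstrap: the derivative of [y 3] is expressed by the equation through [y 0], [y 1], [y 2] and
    the smooth density, to which the induction hypothesis applies. *)
Let y_smoothn n i : (i < 4)%N -> smoothn E n (y i).
Proof.
have E0 x : 0 <= E x by exact: expR_ge0.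
elim: n i => [|n ih] i i4.
  by split => //; apply: y_bound; exact: ltnW.
split; first by apply: y_bound; exact: ltnW.
exists (y i.+1); first by move=> x _; exact: y_derive.
move: i4; rewrite ltnS leq_eqVlt => /predU1P[->|i3]; last exact: (ih i.+1).
have la0 := lam_gt0 kt; set la := lam t in la0.
have sC (c : R) u : smoothn E n u -> smoothn E n (fun x => c * u x).
  by apply: smoothnM => //; exact: smoothn_cst.
have sP (c : R) u : smoothn E n u -> smoothn E n (fun x => c * (rho0 x * u x)).
  by move=> su; apply: sC; exact: smoothnM.
have sp (c : R) u : smoothn E n u ->
    smoothn E n (fun x => c * ((rho0^`())%classic x * u x)).
  by move=> su; apply: sC; exact: smoothnM.
have h0 := ih 0%N isT; have h1 := ih 1%N isT; have h2 := ih 2%N isT.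
have := smoothnD (smoothnD (smoothnD (sP (- (la / mu * k ^+ 2)) _ h0)
  (smoothnD (sC (- k ^+ 4) _ h0) (sp (g * k ^+ 2 / mu * la^-1) _ h0)))
  (sp (la / mu) _ h1)) (smoothnD (sP (la / mu) _ h2) (sC (2 * k ^+ 2) _ h2)).
apply: smoothn_ext.
move=> x x0; case: sy => _ _ /(_ x (ltW x0)) /(Lop_solve _ _ _ la0) ->.
by rewrite /cf0 /cf1 /cf2 P_rho// p_rho//; ring.
Qed.

Let phi x : R[i] := (y 0%N x)%:C.

Let phi_Hinfty : in_Hinfty phi.
Proof. by move=> m; apply: smoothn_in_H k0 _; exact: y_smoothn. Qed.

Let phi_nontrivial : nontrivial phi.
Proof.
have [x xl yx] : exists2 x, x <= l & y 0%N x != 0.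
  apply: contrapT => H.
  have z x : x <= l -> s1 * expR (k * (x - l)) + s2 * expR (t * (x - l)) = 0.
    move=> xl; have [yx|yx] := eqVneq (y 0%N x) 0; last by case: H; exists x.
    by rewrite -[RHS]yx yl// !expr0 !mulr1.
  (* Vanishing at the two points [l] and [l - 1] already forces [s1 = s2 = 0], since [t] and [k]
     differ. *)
  have z0 : s1 + s2 = 0 by have := z l (lexx _); rewrite subrr !mulr0 expR0 !mulr1.
  have l1 : l - 1 <= l by rewrite gerBl.
  have e1 : l - 1 - l = - 1 by ring.
  have := z _ l1; rewrite e1 !mulrN1.
  have -> : s1 = - s2 by apply/eqP; rewrite -subr_eq0 opprK z0.
  rewrite mulNr addrC -mulrBr => /eqP; rewrite mulf_eq0 subr_eq0.
  have [s20|s20 /=] := eqVneq s2 0.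
    move: z0; rewrite s20 addr0 => s10.
    by case: s12; rewrite ?s10 ?s20 eqxx.
  move=> /eqP /expR_inj /eqP; rewrite eqr_opp => /eqP tk.
  by move: kt; rewrite tk ltxx.
move=> [N [mN N0 sub]].
have yc : continuous (y 0%N).
  by apply: derive_continuous => z; exact: y_derive.
have e0 : 0 < `|y 0%N x| / 2 by rewrite divr_gt0// normr_gt0.
have [r r0 hr] := continuous_ball (@yc x) e0.
(* Since [x <= l], the bound [- l] keeps []x, x + r'[] inside the open half-line. *)
pose r' := Num.min r (- l).
have r'0 : 0 < r' by rewrite lt_min r0 oppr_gt0.
have sI : `]x, (x + r')[ `<=` N.
  move=> z /=; rewrite in_itv/= => /andP[xz zr]; apply: sub => /=.
  have zx : `|z - x| < r.
    rewrite gtr0_norm ?subr_gt0// ltrBlDl (lt_le_trans zr)//.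
    by rewrite lerD2l ge_min lexx.
  have z0 : z < 0.
    rewrite (lt_le_trans zr)// -lerBrDl sub0r (@le_trans _ _ (- l))//.
      by rewrite ge_min lexx orbT.
    by rewrite lerN2.
  move=> H; have := hr z zx.
  have -> : y 0%N z = 0 by have [] := H z0.
  rewrite sub0r normrN leNgt => /negP; apply.
  by rewrite ltr_pdivrMr// ltr_pMr ?normr_gt0// ltr1n.
have : (lebesgue_measure `]x, (x + r')%R[%classic <= lebesgue_measure N)%E.
  by apply: le_measure => //; rewrite inE//; exact: measurable_itv.
rewrite N0 lebesgue_measure_itv/= lte_fin ltrDl r'0 -EFinD addrC addKr.
by rewrite lee_fin leNgt r'0.
Qed.

Let phi_bvp : bvp_solution g mu k rhop rho0 (lam t)%:C phi.
Proof.
have la0 := lam_gt0 kt.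
have [jy y4c Ly] := sy.
have yc i : (i <= 4)%N -> continuous (y i).
  by rewrite leq_eqVlt => /predU1P[->//|i4]; exact: jet_continuous.
exists (fun i x => (y i x)%:C),
  (fun x => ((rho0^`())%classic x * y 1%N x + rho0 x * y 2%N x)%:C).
split.
- split; first split.
  + exact: ae_eq_refl.
  + move=> j j4; have [C _ hC] := y_bound j4.
    by apply: square_integrable_real k0 _ hC => x _; exact: yc.
  + move=> j j4; apply: weak_derivative_real => x _; first exact: y_derive.
    exact: yc.
  + move=> j j4; split => /=; apply: continuous_subspaceT.
      by apply: yc; exact: ltnW.
    by move=> x; exact: cvg_cst.
- have -> : (fun x => (rho0 x)%:C * (y 1%N x)%:C) = (fun x => (rho0 x * y 1%N x)%:C).
    by apply/funext => x; rewrite rmorphM.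
  have dr (x : R) : x < 0 -> is_derive x 1 rho0 ((rho0^`())%classic x).
    move=> x0; have [_ [v /(_ x x0) dv _]] := rho_smoothn 1.
    by rewrite derive1E derive_val.
  apply: weak_derivative_real => x x0.
    by apply: pder_eq (pderM (dr x x0) (y_derive x (isT : (1 < 4)%N))) _.
  apply: cvgD; apply: cvgM.
  + exact: smoothn_continuous (drho_smoothn 1) x0.
  + exact: yc.
  + exact: smoothn_continuous (rho_smoothn 1) x0.
  + exact: yc.
- apply: aeW => x x0; apply/eqP; rewrite eq_complex; apply/andP.
  have := Ly x (ltW x0); rewrite /Lop P_rho// p_rho// => H.
  split; apply/eqP; rewrite /= !expr2/=; last by ring.
  apply/eqP; rewrite -subr_eq0; apply/eqP; rewrite -[RHS]H.
  ring.
- split; apply/eqP; rewrite eq_complex; apply/andP.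
  + split; apply/eqP => /=; last by ring.
    by rewrite !mul0r !subr0 -/(bc1 y) y1 mulr0.
  + split; apply/eqP; rewrite /= ?expr2/=; last by ring.
    by rewrite -[RHS]y2 /bc2 P_rhop; ring.
- split => /=; last exact: cvg_cst.
  have [C C0 hC] := y_bound (isT : (0 <= 4)%N).
  apply/cvgrPdist_le => e e0.
  have C1 : 0 < C + 1 by rewrite ltr_wpDl.
  have d0 : 0 < e / (C + 1) by rewrite divr_gt0.
  near=> x; rewrite sub0r normrN.
  have x0 : x < 0 by near: x; apply: nbhs_ninfty_lt; exact: num_real.
  have xk : x < ln (e / (C + 1)) / k by near: x; apply: nbhs_ninfty_lt; exact: num_real.
  rewrite (le_trans (hC x x0))//.
  have : E x <= e / (C + 1).
    rewrite /E -[leRHS]lnK ?posrE// ler_expR mulrC.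
    by rewrite -ler_pdivlMr// ltW.
  rewrite ler_pdivlMr// => H; apply: le_trans H.
  by rewrite mulrC ler_wpM2l ?expR_ge0// lerDl.
Unshelve. all: by end_near. Qed.

Lemma char_bvp_solution : exists psi : R -> R[i],
  [/\ in_Hinfty psi, nontrivial psi & bvp_solution g mu k rhop rho0 (lam t)%:C psi].
Proof. by exists phi; split. Qed.

End characteristic.

Lemma small_characteristic (rho0 : R -> R) (rhop x0 e : R) :
  (forall x, x < 0 -> P x = rho0 x) -> P 0 = rhop ->
  (forall x, x < 0 -> p x = (rho0^`())%classic x) ->
  (forall n m, smoothn (fun=> 1) m (rho0^`(n))%classic) ->
  l < x0 < 0 -> 0 < p x0 -> 0 < e ->
  exists la : R, 0 < la < e /\ exists psi : R -> R[i],
    [/\ in_Hinfty psi, nontrivial psi & bvp_solution g mu k rhop rho0 la%:C psi].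
Proof.
move=> P_rho P_rhop p_rho rho_smooth lx px e0.
(* [lam] is increasing to the right of [k], so any characteristic [t < T] has
   [lam t < lam T <= e]. *)
have [T /andP[kT _] Te] := lam_small (ltr_pwDr ltr01 (lexx k)) e0.
have [t /andP[kt tT] [y [s1 [s2 [s12 sy y1 y2 yl]]]]] := exists_char kT lx px.
exists (lam t); split.
  rewrite lam_gt0//= (lt_le_trans _ Te)// /lam ltr_pM2r ?invr_gt0// ltr_pM2l//.
  by rewrite ltrD2r ltr_pXn2r// nnegrE ltW// (lt_trans k0)// (lt_trans kt).
exact (@char_bvp_solution rho0 rhop P_rho P_rhop p_rho rho_smooth t y s1 s2
  kt sy y1 y2 s12 yl).
Qed.

End problem.

(** Each term is chosen below both its predecessor and the harmonic sequence: the first gives strict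
    decrease, the second convergence to 0. *)
Lemma decreasing_selection (R : realType) (Q : R -> Prop) :
  (forall e, 0 < e -> exists x, 0 < x < e /\ Q x) ->
  exists u : nat -> R, [/\ decreasing_seq u, u n @[n --> \oo] --> (0 : R) &
    forall n, 0 < u n /\ Q (u n)].
Proof.
move=> hQ.
have /choice[G hG] : forall e, exists x, 0 < e -> 0 < x < e /\ Q x.
  move=> e; have [e0|e0] := ltP 0 e; last by exists 0.
  by have [x hx] := hQ e e0; exists x.
pose u := fix u n := if n is m.+1 then G (Num.min (u m) m.+1%:R^-1) else G 1.
have u0 n : 0 < u n.
  elim: n => [|n ih] /=; first by have [/andP[]] := hG 1 ltr01.
  have [|/andP[]//] := hG (Num.min (u n) n.+1%:R^-1).
  by rewrite lt_min ih invr_gt0 ltr0Sn.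
have m0 n : 0 < Num.min (u n) n.+1%:R^-1 by rewrite lt_min u0 invr_gt0 ltr0Sn.
have uS n : u n.+1 < Num.min (u n) n.+1%:R^-1.
  by have [/andP[]] := hG _ (m0 n).
exists u; split.
- by apply/decreasing_seqP => n; have := uS n; rewrite lt_min => /andP[].
- rewrite -cvg_shiftS; apply: (@squeeze_cvgr _ _ _ _ (fun=> 0) (@harmonic R)).
  + near=> n; apply/andP; split; first exact: ltW (u0 _).
    by have := uS n; rewrite lt_min => /andP[_ /ltW].
  + exact: cvg_cst.
  + exact: cvg_harmonic.
- case=> [|n]; split => //; first by have [] := hG 1 ltr01.
  by have [] := hG _ (m0 n).
Unshelve. all: by end_near. Qed.

Unset Implicit Arguments.

Theorem theorem2p1 (R : realType) (g mu a rhom rhop : R) (rho0 : R -> R)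
    (L : R) (kv : 'rV[R]_2)
    (hg : 0 < g) (hmu : 0 < mu) (ha : 0 < a)
    (hrho : density_assumption a rhom rhop rho0)
    (hL : 0 < L) (hk : frequency_lattice L kv) (hk0 : kv != 0) :
  let k := euclidean_norm kv in
  exists lam : nat -> R,
    [/\ forall n : nat, characteristic_value g mu k rhop rho0 (lam n)%:C,
        decreasing_seq lam,
        lam n @[n --> \oo] --> (0 : R) &
        forall n : nat, exists phi : R -> R[i],
          [/\ in_Hinfty phi, nontrivial phi &
              bvp_solution g mu k rhop rho0 (lam n)%:C phi]].
Proof.
move=> k.
have k0 : 0 < k.
  rewrite /k /euclidean_norm sqrtr_gt0 lt_neqAle eq_sym sumr_ge0 ?andbT; last first.
    by move=> i _; exact: sqr_ge0.
  apply: contra hk0; rewrite psumr_eq0 => [/allP H|i _]; last exact: sqr_ge0.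
  apply/eqP/rowP => i; rewrite mxE; apply/eqP.
  by have := H i (mem_index_enum _); rewrite /= sqrf_eq0.
have [x0 ax px] := drho_pos hrho ha.
have rm0 : 0 < rhom by have [_ _ _ []] := hrho.
have al : - a < 0 by rewrite oppr_lt0.
have acc e : 0 < e -> exists la : R, 0 < la < e /\ exists psi : R -> R[i],
    [/\ in_Hinfty psi, nontrivial psi & bvp_solution g mu k rhop rho0 la%:C psi].
  move=> e0.
  apply: (small_characteristic hg hmu k0 rm0 al (drho_left0 hrho ha)
    (rho_derive hrho ha) (rho_left hrho ha)) ax px e0.
  - by move=> x /andP[_ xle]; exact: rho_gt0 hrho ha _ xle.
  - by move=> x; exact: rho_neg hrho ha x.
  - exact: rho_0 hrho ha.
  - by move=> x; exact: drho_neg.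
  - exact: rho0_smoothn hrho.
have [lam [ldec lcv lch]] := decreasing_selection acc.
exists lam; split => // n; have [l0 [psi [h1 h2 h3]]] := lch n; last by exists psi.
by split; [exact: l0|exists psi; split => //; exact: h1].
Qed.
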